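(* Let $n\in\omega$. Every $\Pi^0_1$ subset $P$ of the Hilbert cube $[0,1]^\omega$ of topological dimension $n$ is computably embedded into the Nöbeling space $N^{2n+1}_n$, i.e., there is a computable injection $f\colon P\to N^{2n+1}_n$ with a computable left inverse $g\colon f[P]\to P$.
   Context: $[0,1]^\omega$ carries its standard computable metric structure (dense set of rational sequences with finitely many nonzero terms and a computable product metric). A $\Pi^0_1$ subset is the complement of a union of a computable sequence of rational open balls. A partial function between computable metric spaces is computable if some partial computable map on $\omega^\omega$ sends Cauchy names (sequences $p$ with $d(a_{p(n)},a_{p(m)})<2^{-n}$ for $m\ge n$) of points of its domain to names of their images. The Nöbeling space $N^m_n$ is the set of $(x_\ell)_{\ell<m}\in\mathbb{R}^m$ such that at most $n$ of the coordinates $x_\ell$ are rational. *)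

(* Defs.v *)
From HB Require Import structures.
From mathcomp Require Import all_boot all_order all_algebra.
From mathcomp Require Import all_classical all_reals all_analysis.

Set Implicit Arguments.
Unset Strict Implicit.
Unset Printing Implicit Defensive.

Import Order.TTheory GRing.Theory Num.Theory.
Import numFieldNormedType.Exports.

Local Open Scope classical_set_scope.
Local Open Scope ring_scope.

(** Kleene's mu-recursive functions relative to an oracle in Baire space.
    Arities are not tracked: the basic functions read a missing argument as 0
    and ignore superfluous ones. *)
Inductive prog : Type :=
| Zero
| Succ
| Proj of nat
| Oracle
| Comp of prog & seq prog
| Prec of prog & prog
| Mu of prog.

(** [prog_eval p e xs y]: with oracle [p], the program [e] halts on the
    arguments [xs] with output [y]. *)
Inductive prog_eval (p : nat -> nat) : prog -> seq nat -> nat -> Prop :=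
| prog_eval_Zero xs : prog_eval p Zero xs 0
| prog_eval_Succ xs : prog_eval p Succ xs (nth 0%N xs 0).+1
| prog_eval_Proj i xs : prog_eval p (Proj i) xs (nth 0%N xs i)
| prog_eval_Oracle xs : prog_eval p Oracle xs (p (nth 0%N xs 0))
| prog_eval_Comp f gs xs ys y :
    size ys = size gs ->
    (forall i, (i < size gs)%N ->
       prog_eval p (nth Zero gs i) xs (nth 0%N ys i)) ->
    prog_eval p f ys y ->
    prog_eval p (Comp f gs) xs y
| prog_eval_Prec0 f g xs y :
    prog_eval p f xs y ->
    prog_eval p (Prec f g) (0%N :: xs) y
| prog_eval_PrecS f g n xs y z :
    prog_eval p (Prec f g) (n :: xs) y ->
    prog_eval p g [:: n, y & xs] z ->
    prog_eval p (Prec f g) (n.+1 :: xs) z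
| prog_eval_Mu f xs n (v : nat -> nat) :
    prog_eval p f (n :: xs) 0 ->
    (forall i, (i < n)%N -> prog_eval p f (i :: xs) (v i).+1) ->
    prog_eval p (Mu f) xs n.

(** A program [e] computes the partial map on Baire space sending [p] to [q];
    the value at [p] is undefined if [e] diverges on some input [k]. *)
Definition baire_graph (e : prog) (p q : nat -> nat) : Prop :=
  forall k, prog_eval p e [:: k] (q k).

Definition computable_seq (h : nat -> nat) : Prop :=
  exists e : prog, baire_graph e (fun=> 0%N) h.

(** [CodeSeq.decode] is MathComp's computable bijection from [nat] to
    [seq nat]. The code of [[:: a; b; c]] represents (a - b) / (c + 1), hence
    every rational has a code; the code 0 represents 0. *)
Definition rat_of_code (k : nat) : rat :=
  let s := CodeSeq.decode k in
  ((nth 0%N s 0)%:R - (nth 0%N s 1)%:R) / (nth 0%N s 2).+1%:R.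

(** Finitely supported rational sequences. *)
Definition ratseq_of_code (k l : nat) : rat :=
  rat_of_code (nth 0%N (CodeSeq.decode k) l).

Section ComputableMetric.
Context {R : realType}.

(** Cauchy names with respect to a metric [d] and a dense sequence [a]. *)
Definition cauchy_name {X : Type} (d : X -> X -> R) (a : nat -> X)
    (p : nat -> nat) (x : X) : Prop :=
  (forall n m, (n <= m)%N -> d (a (p n)) (a (p m)) < 2^-1 ^+ n) /\
  (d (a (p n)) x @[n --> \oo] --> 0).

Definition computable_on {X Y : Type}
    (dX : X -> X -> R) (aX : nat -> X) (dY : Y -> Y -> R) (aY : nat -> Y)
    (D : set X) (f : X -> Y) : Prop :=
  exists e : prog, forall x p, D x -> cauchy_name dX aX p x ->
    exists2 q, baire_graph e p q & cauchy_name dY aY q (f x).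

Definition hilbert_cube : set {ptws nat -> R} :=
  [set x | forall l, 0 <= x l <= 1].

Definition cube_dist (x y : {ptws nat -> R}) : R :=
  limn (series (fun l => `|x l - y l| / 2 ^+ l.+1)).

(** Truncating the entries to [0,1] yields all finitely supported rational
    points of the cube. *)
Definition cube_dense (k : nat) : {ptws nat -> R} :=
  fun l => ratr (Num.min 1 (Num.max 0 (ratseq_of_code k l))).

(** The norm on row vectors is the maximum norm. *)
Definition rvec_dist (m : nat) (x y : 'rV[R]_m) : R := `|x - y|.

Definition rvec_dense (m : nat) (k : nat) : 'rV[R]_m :=
  \row_(l < m) ratr (ratseq_of_code k l).

(** A nonpositive radius gives the empty ball, so that the whole cube is
    Pi^0_1 as well. *)
Definition Pi01_cube (P : set {ptws nat -> R}) : Prop :=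
  exists c r : nat -> nat, [/\ computable_seq c, computable_seq r &
    P = hilbert_cube `\` \bigcup_k
          [set x | cube_dist x (cube_dense (c k)) < ratr (rat_of_code (r k))]].

Definition nobeling (m n : nat) : set 'rV[R]_m :=
  [set x : 'rV[R]_m | (#|[pred l : 'I_m | `[< rational (x ord0 l) >]]| <= n)%N].

End ComputableMetric.

(** The Lebesgue covering dimension of the subspace [P] is less than [k]: every
    finite open cover has a finite open refinement in which each point lies in
    at most [k] members. The relatively open sets are the traces on [P] of open
    sets of [T]. For [k = 0] this says that [P] is empty. *)
Definition covering_dim_lt (T : topologicalType) (P : set T) (k : nat) : Prop :=
  forall (a : nat) (U : 'I_a -> set T),
    (forall i, open (U i)) -> P `<=` \bigcup_i U i ->
  exists (b : nat) (V : 'I_b -> set T),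
    [/\ forall j, open (V j),
        P `<=` \bigcup_j V j,
        forall j, exists i, P `&` V j `<=` U i &
        forall x, P x -> (#|[pred j : 'I_b | `[< V j x >]]| <= k)%N].

Definition covering_dim_eq (T : topologicalType) (P : set T) (n : nat) : Prop :=
  covering_dim_lt P n.+1 /\ ~ covering_dim_lt P n.

(* Main.v *)
Require Import Defs.
From HB Require Import structures.
From mathcomp Require Import all_boot all_order all_algebra.
From mathcomp Require Import all_classical all_reals all_analysis.
From mathcomp Require Import zify ring lra.

Set Implicit Arguments.
Unset Strict Implicit.
Unset Printing Implicit Defensive.

Import Order.TTheory GRing.Theory Num.Theory.
Import numFieldNormedType.Exports.

Local Open Scope classical_set_scope.
Local Open Scope ring_scope.

(** Effective Baire category.  A map from [P] is described by a sequence of finite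
    tables: each lists finitely many rational points whose small balls cover
    [P], and for each of them a rational vector that approximates the value
    nearby.  The next table is found by unbounded search for one that refines the
    previous one, separates points at distance [2^-s], and whose values have at
    most [n] coordinates close to one of the first [s] rationals.  All these
    conditions are decidable, since the covering of [P] is certified on a finite
    grid by compactness.  The limit is computable, and its inverse is read off
    the tables.

    The search succeeds because [P] has dimension at most [n]: a fine open cover of
    order [n + 1] with a partition of unity sends [P] to a complex whose vertices
    can be placed in general position near the values of the previous table.  Any
    [2n + 2] vertices are then affinely independent, so faraway points are
    separated, and no convex combination of [n + 1] vertices has [n + 1] prescribed
    rational coordinates. *)

(** * Computability *)

(** The dimension hypothesis provides no algorithm: neither covers of order [n + 1] nor vertices in
    general position are ever computed. They only guarantee that a decidable search over rational
    data ends. Two choices shape the tables. A refined value may move by at most the old tolerance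
    minus the new one, so the closed boxes with the tolerance as radius are nested, and what a table
    establishes with enough slack (separation, avoidance of a rational) survives in the limit. And
    overlapping balls of one table must carry close values; this invariant, [tab_tame], together
    with the covering certificate lets every valid table be extended, so the greedy choice of the
    least extension never gets stuck. *)

Fixpoint deoracle (e : prog) : prog :=
  match e with
  | Oracle => Zero
  | Comp f gs => Comp (deoracle f) (map deoracle gs)
  | Prec f g => Prec (deoracle f) (deoracle g)
  | Mu f => Mu (deoracle f)
  | _ => e
  end.

(** Computable sequences come with programs run under the zero oracle. Since [Zero] returns 0 on
    every argument, substituting it for oracle calls makes such a program usable under any
    oracle. *)
Lemma prog_eval_deoracle p e xs y :
  prog_eval (fun=> 0%N) e xs y -> prog_eval p (deoracle e) xs y.
Proof.
elim=> {e xs y}.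
- by move=> xs; apply: prog_eval_Zero.
- by move=> xs; apply: prog_eval_Succ.
- by move=> i xs; apply: prog_eval_Proj.
- by move=> xs; apply: prog_eval_Zero.
- move=> f gs xs ys y szy _ IHg _ IHf /=; apply: prog_eval_Comp IHf.
    by rewrite size_map.
  move=> i; rewrite size_map => ilt.
  by rewrite (nth_map Zero) //; apply: IHg.
- by move=> f g xs y _ IH /=; apply: prog_eval_Prec0.
- by move=> f g n xs y z _ IH1 _ IH2 /=; apply: prog_eval_PrecS IH1 IH2.
- by move=> f xs n v _ IH0 _ IHv /=; apply: prog_eval_Mu IH0 IHv.
Qed.

(** A quantity [G] depending on a state [x] is computable from the numbers
    [v x], [v \in vs], and the oracle [o x]. Keeping the state type [E]
    arbitrary lets bound variables be pairings [nat * E]. *)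
Definition cmp (E : Type) (o : E -> nat -> nat) (vs : seq (E -> nat))
    (G : E -> nat) : Prop :=
  exists e, forall x, prog_eval (o x) e [seq v x | v <- vs] (G x).

(** De Bruijn style: the newest bound variable is [fst], older ones are reached through [snd], and
    the oracle ignores all of them. *)
Definition ext E (vs : seq (E -> nat)) : seq (nat * E -> nat) :=
  fst :: [seq v \o snd | v <- vs].
Definition oext E (o : E -> nat -> nat) : nat * E -> nat -> nat := o \o snd.

Lemma eq_cmp E (o : E -> nat -> nat) vs G G' :
  G =1 G' -> cmp o vs G -> cmp o vs G'.
Proof. by move=> /funext ->. Qed.

Lemma cmp_var E (o : E -> nat -> nat) vs i :
  (i < size vs)%N -> cmp o vs (nth (fun=> 0%N) vs i).
Proof.
move=> ilt; exists (Proj i) => x.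
rewrite -[X in prog_eval _ _ _ X](@nth_map _ (fun=> 0%N) _ 0%N (fun v => v x)) //.
exact: prog_eval_Proj.
Qed.

Lemma cmp_Zero E (o : E -> nat -> nat) vs : cmp o vs (fun=> 0%N).
Proof. by exists Zero => x; apply: prog_eval_Zero. Qed.

Lemma cmp_progs E (o : E -> nat -> nat) vs (As : seq (E -> nat)) :
  (forall i, (i < size As)%N -> cmp o vs (nth (fun=> 0%N) As i)) ->
  exists es : seq prog, size es = size As /\
    forall i, (i < size es)%N -> forall x,
      prog_eval (o x) (nth Zero es i) [seq v x | v <- vs]
        (nth 0%N [seq A x | A <- As] i).
Proof.
elim: As => [|A As IH] cA; first by exists [::].
have [e he] := cA 0%N isT.
have [es [szes hes]] := IH (fun i => cA i.+1).
exists (e :: es); split=> [|[|i] ilt x]; first by rewrite /= szes.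
  exact: he.
exact: hes.
Qed.

Lemma cmp_subst E (o : E -> nat -> nat) vs ws G :
  (forall i, (i < size vs)%N -> cmp o ws (nth (fun=> 0%N) vs i)) ->
  cmp o vs G -> cmp o ws G.
Proof.
move=> /cmp_progs[es [szes hes]] [e he]; exists (Comp e es) => x.
apply: prog_eval_Comp (he x); first by rewrite size_map szes.
by move=> i ilt; apply: hes.
Qed.

Lemma cmp_lift E E' (h : E' -> E) (o : E -> nat -> nat) vs G :
  cmp o vs G -> cmp (o \o h) [seq v \o h | v <- vs] (G \o h).
Proof.
move=> [e he]; exists e => x; have := he (h x).
by rewrite -map_comp.
Qed.

Lemma cmp_weak E (o : E -> nat -> nat) vs G :
  cmp o vs G -> cmp (oext o) (ext vs) (fun y => G y.2).
Proof.
move=> /(cmp_lift (@snd nat E)); apply: cmp_subst => i.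
by rewrite size_map => ilt; apply: (@cmp_var _ _ (ext vs) i.+1); rewrite /= size_map.
Qed.

(** Transfer between state types: an operation shown computable on a state type of its own is
    applied to computed arguments [As], because [h] pulls its variables back to them. *)
Lemma cmp_app E (o : E -> nat -> nat) vs E' (o' : E' -> nat -> nat)
    (As : seq (E -> nat)) (h : E -> E') ws G :
  (forall x, o' (h x) = o x) ->
  [seq v \o h | v <- ws] = As ->
  (forall i, (i < size As)%N -> cmp o vs (nth (fun=> 0%N) As i)) ->
  cmp o' ws G -> cmp o vs (fun x => G (h x)).
Proof.
move=> /funext oE AsE cA /(cmp_lift h); rewrite AsE (_ : o' \o h = o) //.
exact: cmp_subst.
Qed.

Lemma cmp_oracle E (o : E -> nat -> nat) vs A :
  cmp o vs A -> cmp o vs (fun x => o x (A x)).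
Proof.
move=> cA; apply: (@cmp_app E o vs _ (@fst (nat -> nat) nat) [:: A]
  (fun x => (o x, A x)) [:: snd] (fun y => y.1 y.2)) => //; first by case.
by exists Oracle => y; apply: prog_eval_Oracle.
Qed.

Lemma cmp_S E (o : E -> nat -> nat) vs A : cmp o vs A -> cmp o vs (fun x => (A x).+1).
Proof.
move=> cA; apply: (@cmp_app E o vs _ (@fst (nat -> nat) nat) [:: A]
  (fun x => (o x, A x)) [:: snd] (fun y => y.2.+1)) => //; first by case.
by exists Succ => y; apply: prog_eval_Succ.
Qed.

Lemma cmp_const E (o : E -> nat -> nat) vs c : cmp o vs (fun=> c).
Proof. by elim: c => [|c IH]; [exact: cmp_Zero|exact: cmp_S]. Qed.

Lemma cmp_seq E (o : E -> nat -> nat) vs h A :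
  computable_seq h -> cmp o vs A -> cmp o vs (fun x => h (A x)).
Proof.
move=> [e he] cA; apply: (@cmp_app E o vs _ (@fst (nat -> nat) nat) [:: A]
  (fun x => (o x, A x)) [:: snd] (fun y => h y.2)) => //; first by case.
by exists (deoracle e) => y; apply: prog_eval_deoracle; apply: he.
Qed.

Lemma cmp_rec E (o : E -> nat -> nat) vs N A (S : nat -> nat -> E -> nat) :
  cmp o vs N -> cmp o vs A ->
  cmp (oext (oext o)) (ext (ext vs)) (fun y => S y.1 y.2.1 y.2.2) ->
  cmp o vs (fun x => iteri (N x) (fun i a => S i a x) (A x)).
Proof.
move=> cN [eA hA] [eS hS].
apply: (@cmp_app E o vs (nat * E) (oext o) (N :: vs) (fun x => (N x, x)) (ext vs)
  (fun y => iteri y.1 (fun i a => S i a y.2) (A y.2))) => //.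
- by rewrite /= -map_comp; congr (_ :: _); rewrite -[RHS]map_id; apply: eq_map.
- by case=> [|i] //=; apply: cmp_var.
- exists (Prec eA eS) => -[n x] /=; rewrite -map_comp /oext /=.
  rewrite (eq_map (g := fun v => v x)) //.
  elim: n => [|n IH]; first by apply: prog_eval_Prec0; apply: hA.
  apply: (prog_eval_PrecS IH) => /=.
  have := hS (n, (iteri n (fun i a => S i a x) (A x), x)).
  by rewrite /= -!map_comp /oext /= (eq_map (g := fun v => v x)).
Qed.

(** Discards a bound variable on which the goal does not depend, by evaluating it at 0 and invoking
    [cmp_weak]. *)
Ltac cmp_weaken :=
  match goal with |- cmp (oext ?o) (ext ?vs) ?G =>
    let T := type of G in
    match T with prod nat ?E -> _ =>
    let G' := eval cbn beta iota delta [fst snd] in (fun x : E => G (0%N, x)) in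
    change (cmp (oext o) (ext vs) (fun y : prod nat E => G' (snd y)));
    apply: (@cmp_weak E o vs G')
    end
  end.

Ltac cmp_nth i :=
  match goal with |- cmp ?o ?vs _ => exact (@cmp_var _ o vs i isT) end.

Ltac cmp_leaf := first
  [ assumption | exact: cmp_const
  | cmp_nth 0%N | cmp_nth 1%N | cmp_nth 2%N | cmp_nth 3%N | cmp_nth 4%N
  | cmp_weaken; cmp_leaf ].

Section Predecessor.
Context (E : Type) (o : E -> nat -> nat) (vs : seq (E -> nat)).
Implicit Types (A B N : E -> nat) (P Q : E -> bool).

Definition bcmp P := cmp o vs (fun x => nat_of_bool (P x)).

Lemma cmp_pred A : cmp o vs A -> cmp o vs (fun x => (A x).-1).
Proof.
move=> cA; apply: eq_cmp (cmp_rec (S := fun i _ _ => i) cA (cmp_const o vs 0) _).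
  by move=> x; case: (A x).
by cmp_leaf.
Qed.
End Predecessor.

Section Additive.
Context (E : Type) (o : E -> nat -> nat) (vs : seq (E -> nat)).
Implicit Types (A B N : E -> nat) (P Q : E -> bool).

Lemma cmp_add A B : cmp o vs A -> cmp o vs B -> cmp o vs (fun x => (A x + B x)%N).
Proof.
move=> cA cB; apply: eq_cmp (cmp_rec (S := fun _ a _ => a.+1) cA cB _).
  by move=> x; elim: (A x) => //= n ->.
by apply: cmp_S; cmp_leaf.
Qed.

Lemma cmp_sub A B : cmp o vs A -> cmp o vs B -> cmp o vs (fun x => (A x - B x)%N).
Proof.
move=> cA cB; apply: eq_cmp (cmp_rec (S := fun _ a _ => a.-1) cB cA _).
  by move=> x; elim: (B x) => /= [|n ->]; rewrite ?subn0 ?subnS.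
by apply: cmp_pred; cmp_leaf.
Qed.
End Additive.

(** In [cmp_rec] the accumulator sits between the index and the outer state; this inserts it for a
    function that does not read it. *)
Lemma cmp_ext_weak E (o : E -> nat -> nat) vs (F : nat -> E -> nat) :
  cmp (oext o) (ext vs) (fun y => F y.1 y.2) ->
  cmp (oext (oext o)) (ext (ext vs)) (fun y => F y.1 y.2.2).
Proof.
apply: (@cmp_app _ _ _ _ (oext o) (fst :: [seq v \o snd \o snd | v <- vs])
   (fun y : nat * (nat * E) => (y.1, y.2.2)) (ext vs) (fun y => F y.1 y.2)) => //.
  by rewrite /= -!map_comp.
case=> [|i] ilt; first exact: (@cmp_var _ _ (ext (ext vs)) 0%N).
rewrite -[X in cmp _ _ X]/(nth (fun=> 0%N) [seq v \o snd \o snd | v <- vs] i).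
have := @cmp_var _ (oext (oext o)) (ext (ext vs)) i.+2.
by rewrite /= !size_map -!map_comp; apply; move: ilt; rewrite /= size_map.
Qed.

Lemma cmp_sum E (o : E -> nat -> nat) vs (N : E -> nat) (F : nat -> E -> nat) :
  cmp o vs N -> cmp (oext o) (ext vs) (fun y => F y.1 y.2) ->
  cmp o vs (fun x => \sum_(i < N x) F i x)%N.
Proof.
move=> cN cF.
apply: eq_cmp (cmp_rec (S := fun i a x => (a + F i x)%N) cN (cmp_const o vs 0) _).
  by move=> x; elim: (N x) => [|n IH]; rewrite ?big_ord0 //= big_ord_recr IH.
by apply: cmp_add; [cmp_leaf | apply: cmp_ext_weak].
Qed.

Section Connectives.
Context (E : Type) (o : E -> nat -> nat) (vs : seq (E -> nat)).
Implicit Types (A B N : E -> nat) (P Q : E -> bool).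

Lemma cmp_mul A B : cmp o vs A -> cmp o vs B -> cmp o vs (fun x => (A x * B x)%N).
Proof.
move=> cA cB; apply: eq_cmp (cmp_sum (F := fun _ => B) cA _); last by cmp_leaf.
by move=> x; rewrite sum_nat_const card_ord.
Qed.

Lemma bcmp_not P : bcmp o vs P -> bcmp o vs (fun x => ~~ P x).
Proof.
move=> cP; apply: eq_cmp (cmp_sub (cmp_const o vs 1) cP) => x.
by case: (P x).
Qed.

Lemma bcmp_and P Q : bcmp o vs P -> bcmp o vs Q -> bcmp o vs (fun x => P x && Q x).
Proof. by move=> cP cQ; apply: eq_cmp (cmp_mul cP cQ) => x; rewrite mulnb. Qed.

Lemma bcmp_or P Q : bcmp o vs P -> bcmp o vs Q -> bcmp o vs (fun x => P x || Q x).
Proof.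
move=> cP cQ; apply: eq_cmp (bcmp_not (bcmp_and (bcmp_not cP) (bcmp_not cQ))) => x.
by rewrite negb_and !negbK.
Qed.

Lemma bcmp_imp P Q : bcmp o vs P -> bcmp o vs Q -> bcmp o vs (fun x => P x ==> Q x).
Proof.
by move=> cP cQ; apply: eq_cmp (bcmp_or (bcmp_not cP) cQ) => x; rewrite implybE.
Qed.

Lemma bcmp_leq A B : cmp o vs A -> cmp o vs B -> bcmp o vs (fun x => A x <= B x)%N.
Proof.
move=> cA cB; apply: eq_cmp (cmp_sub (cmp_const o vs 1) (cmp_sub cA cB)) => x.
by rewrite -subn_eq0; case: (A x - B x)%N.
Qed.

Lemma bcmp_eqn A B : cmp o vs A -> cmp o vs B -> bcmp o vs (fun x => A x == B x).
Proof.
move=> cA cB; apply: eq_cmp (bcmp_and (bcmp_leq cA cB) (bcmp_leq cB cA)) => x.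
by rewrite eqn_leq.
Qed.

Lemma cmp_if P A B : bcmp o vs P -> cmp o vs A -> cmp o vs B ->
  cmp o vs (fun x => if P x then A x else B x).
Proof.
move=> cP cA cB.
apply: eq_cmp (cmp_add (cmp_mul cP cA) (cmp_mul (bcmp_not cP) cB)) => x.
by case: (P x); rewrite /= ?mul1n ?mul0n ?addn0.
Qed.
End Connectives.

Section Bounded.
Context (E : Type) (o : E -> nat -> nat) (vs : seq (E -> nat)) (N : E -> nat).
Context (P : nat -> E -> bool).
Hypotheses (cN : cmp o vs N).
Hypothesis (cP : bcmp (oext o) (ext vs) (fun y => P y.1 y.2)).

Lemma cmp_count : cmp o vs (fun x => count (P^~ x) (iota 0 (N x))).
Proof.
apply: eq_cmp (cmp_sum (F := fun i x => P i x : nat) cN cP) => x.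
rewrite -sum1_count [RHS]big_mkcond -[X in iota 0 X]subn0 -/(index_iota 0 (N x)) big_mkord.
by apply: eq_bigr => i _; case: (P i x).
Qed.

Lemma bcmp_has : bcmp o vs (fun x => has (P^~ x) (iota 0 (N x))).
Proof.
apply: eq_cmp (bcmp_leq (cmp_const o vs 1) cmp_count) => x.
by rewrite has_count.
Qed.

Lemma bcmp_all : bcmp o vs (fun x => all (P^~ x) (iota 0 (N x))).
Proof.
apply: eq_cmp (bcmp_leq cN cmp_count) => x.
have := count_size (P^~ x) (iota 0 (N x)); rewrite all_count size_iota eqn_leq.
by move=> ->.
Qed.

Lemma cmp_find : cmp o vs (fun x => find (P^~ x) (iota 0 (N x))).
Proof.
(* The accumulator equals [i] exactly while no index below [i] is a hit. At the first hit it stays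
   behind and is frozen; without a hit it ends at the length, as [find] does. *)
apply: eq_cmp (cmp_rec (S := fun i a x => if (a == i) && ~~ P i x then i.+1 else a)
  cN (cmp_const o vs 0) _) => [x|].
  elim: (N x) => // n IH; rewrite -[in RHS](addn1 n) iotaD find_cat /= IH add0n size_iota.
  rewrite has_find size_iota; have := find_size (P^~ x) (iota 0 n); rewrite size_iota.
  case: ltngtP => //= -> _; case: (P n x) => /=; by rewrite ?addn0 ?addn1.
apply: cmp_if; last by cmp_leaf.
  apply: bcmp_and; first by apply: bcmp_eqn; cmp_leaf.
  by apply: bcmp_not; apply: (@cmp_ext_weak _ _ _ (fun i x => P i x)).
by apply: cmp_S; cmp_leaf.
Qed.
End Bounded.


(** * Arithmetic of coded sequences *)

Section CodedSequences.

(** A nonzero code is [2 ^ x * (2 * m + 1)] with head [x] and tail coded by [m]. Both lie below [c],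
    so bounded search finds them; 0 codes the empty list and is read as the default. *)
Definition code_head c :=
  if c == 0%N then 0%N else
  find (fun x => has (fun m => 2 ^ x * m.*2.+1 == c)%N (iota 0 c)) (iota 0 c).
Definition code_tail c :=
  if c == 0%N then 0%N else
  find (fun m => has (fun x => 2 ^ x * m.*2.+1 == c)%N (iota 0 c)) (iota 0 c).
Definition cnth c i := nth 0%N (CodeSeq.decode c) i.

(** No divisibility argument is needed: the two sides are codes of lists, and coding is a
    bijection. *)
Lemma code_factor_inj x m x' m' :
  (2 ^ x * m.*2.+1 = 2 ^ x' * m'.*2.+1 -> x = x' /\ m = m')%N.
Proof.
move=> h; have := CodeSeq.codeK (x :: CodeSeq.decode m).
by rewrite /= CodeSeq.decodeK h -{1}(CodeSeq.decodeK m')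
  -[LHS]/(CodeSeq.decode (CodeSeq.code (x' :: CodeSeq.decode m')))
  CodeSeq.codeK => -[-> /(can_inj CodeSeq.decodeK) ->].
Qed.

Lemma find_iota_eq (P : nat -> bool) n i :
  (i < n)%N -> P i -> (forall j, P j -> j = i) -> find P (iota 0 n) = i.
Proof.
move=> ilt Pi Pu; have hP : has P (iota 0 n).
  by apply/hasP; exists i; rewrite ?mem_iota.
have := nth_find 0%N hP; rewrite nth_iota; first by rewrite add0n => /Pu.
by move: hP; rewrite has_find size_iota.
Qed.

Lemma code_cons_lt x s :
  (x < CodeSeq.code (x :: s))%N /\ (CodeSeq.code s < CodeSeq.code (x :: s))%N.
Proof.
rewrite /=; have := ltn_expl x (ltnSn 1); set a := (2 ^ x)%N; set b := CodeSeq.code s.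
by move=> h; split; nia.
Qed.

Lemma code_headE x s : code_head (CodeSeq.code (x :: s)) = x.
Proof.
have [h1 h2] := code_cons_lt x s.
rewrite /code_head -leqn0 leqNgt (leq_ltn_trans _ h1) //=.
apply: find_iota_eq => //.
  by apply/hasP; exists (CodeSeq.code s); rewrite ?mem_iota //= eqxx.
by move=> j /hasP[m _ /eqP /code_factor_inj[]].
Qed.

Lemma code_tailE x s : code_tail (CodeSeq.code (x :: s)) = CodeSeq.code s.
Proof.
have [h1 h2] := code_cons_lt x s.
rewrite /code_tail -leqn0 leqNgt (leq_ltn_trans _ h1) //=.
apply: find_iota_eq => //.
  by apply/hasP; exists x; rewrite ?mem_iota //= eqxx.
by move=> j /hasP[m _ /eqP /code_factor_inj[]].
Qed.

Lemma cnthE c i : cnth c i = code_head (iteri i (fun _ => code_tail) c).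
Proof.
rewrite /cnth -{2}(CodeSeq.decodeK c).
have -> : iteri i (fun=> code_tail) (CodeSeq.code (CodeSeq.decode c)) =
    CodeSeq.code (drop i (CodeSeq.decode c)).
  elim: i => /= [|i ->]; first by rewrite drop0.
  rewrite -add1n -drop_drop drop1.
  by case: (drop i _) => //= x s; apply: code_tailE.
rewrite -[i in LHS]addn0 -nth_drop; case: (drop i _) => //= x s.
by rewrite -[LHS](code_headE x s).
Qed.
End CodedSequences.

Section Exponentiation.
Context (E : Type) (o : E -> nat -> nat) (vs : seq (E -> nat)).
Implicit Types (A B N : E -> nat).

Lemma cmp_exp A B : cmp o vs A -> cmp o vs B -> cmp o vs (fun x => A x ^ B x)%N.
Proof.
move=> cA cB; apply: eq_cmp (cmp_rec (S := fun _ a x => (A x * a)%N) cB (cmp_const o vs 1) _).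
  by move=> x; elim: (B x) => //= n ->; rewrite expnS.
by apply: cmp_mul; cmp_leaf.
Qed.
End Exponentiation.

Section Factorization.
Context (E : Type) (o : E -> nat -> nat) (vs : seq (E -> nat)).
Implicit Types (A B N : E -> nat).

Lemma bcmp_factor A B D : cmp o vs A -> cmp o vs B -> cmp o vs D ->
  bcmp o vs (fun x => 2 ^ A x * (B x).*2.+1 == D x)%N.
Proof.
move=> cA cB cD; apply: bcmp_eqn => //; apply: cmp_mul.
  by apply: cmp_exp => //; apply: cmp_const.
apply: cmp_S; apply: eq_cmp (cmp_add cB cB) => x; exact: addnn.
Qed.
End Factorization.

Section HeadTail.
Context (E : Type) (o : E -> nat -> nat) (vs : seq (E -> nat)).
Implicit Types (A B N : E -> nat).

Lemma cmp_code_head A : cmp o vs A -> cmp o vs (fun x => code_head (A x)).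
Proof.
move=> cA; apply: cmp_if; [by apply: bcmp_eqn; cmp_leaf|by cmp_leaf|].
apply: (@cmp_find _ _ _ _
  (fun j x => has (fun m => 2 ^ j * m.*2.+1 == A x)%N (iota 0 (A x)))) => //.
apply: (@bcmp_has _ _ _ _ (fun m x => 2 ^ x.1 * m.*2.+1 == A x.2)%N); first by cmp_leaf.
by apply: bcmp_factor; cmp_leaf.
Qed.

Lemma cmp_code_tail A : cmp o vs A -> cmp o vs (fun x => code_tail (A x)).
Proof.
move=> cA; apply: cmp_if; [by apply: bcmp_eqn; cmp_leaf|by cmp_leaf|].
apply: (@cmp_find _ _ _ _
  (fun j x => has (fun m => 2 ^ m * j.*2.+1 == A x)%N (iota 0 (A x)))) => //.
apply: (@bcmp_has _ _ _ _ (fun m x => 2 ^ m * x.1.*2.+1 == A x.2)%N); first by cmp_leaf.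
by apply: bcmp_factor; cmp_leaf.
Qed.
End HeadTail.

Lemma cmp_cnth E (o : E -> nat -> nat) vs A B :
  cmp o vs A -> cmp o vs B -> cmp o vs (fun x => cnth (A x) (B x)).
Proof.
move=> cA cB; apply: eq_cmp (cmp_code_head (cmp_rec (S := fun _ a _ => code_tail a) cB cA _)).
  by move=> x; rewrite cnthE.
by apply: cmp_code_tail; cmp_leaf.
Qed.

(** Unbounded search along a recursion: [W s.+1] is the least [w] such that
    [C s (W s) w]. *)
Lemma cmp_search (C : nat -> nat -> nat -> bool) (W : nat -> nat) :
  (forall s, C s (W s) (W s.+1)) ->
  (forall s w, (w < W s.+1)%N -> ~~ C s (W s) w) ->
  (forall E (o : E -> nat -> nat) vs A B D, cmp o vs A -> cmp o vs B -> cmp o vs D ->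
     bcmp o vs (fun x => C (A x) (B x) (D x))) ->
  forall E (o : E -> nat -> nat) vs N, cmp o vs N -> cmp o vs (fun x => W (N x)).
Proof.
move=> WC Wmin cC E o vs N cN.
(* The arguments of the test are ordered as [Mu] inside [Prec] supplies them: candidate, stage,
   previous value. [Mu] looks for a zero, hence the negation of [C]. *)
pose T := ((nat -> nat) * (nat * (nat * nat)))%type.
have [e he] : bcmp (E := T) fst
    [:: fun y => y.2.1; fun y => y.2.2.1; fun y => y.2.2.2]
    (fun y => ~~ C y.2.2.1 y.2.2.2 y.2.1).
  by apply: bcmp_not; apply: cC; cmp_leaf.
have [e0 he0] : cmp (E := nat -> nat) id [::] (fun=> W 0%N) by exact: cmp_const.
apply: (@cmp_app E o vs _ (@fst (nat -> nat) nat) [:: N]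
  (fun x => (o x, N x)) [:: snd] (fun y => W y.2)) => //; first by case.
exists (Prec e0 (Mu e)) => -[p n] /=; elim: n => [|n IH].
  by apply: prog_eval_Prec0; apply: he0.
apply: (prog_eval_PrecS IH); apply: (@prog_eval_Mu _ _ _ _ (fun=> 0%N)).
  by have := he (p, (W n.+1, (n, W n))); rewrite /= WC.
by move=> i ilt; have := he (p, (i, (n, W n))); rewrite /= Wmin.
Qed.

(** * Rational-valued computable quantities *)

Section RationalClosure.
Context (E : Type) (o : E -> nat -> nat) (vs : seq (E -> nat)).

(** The fraction has the shape of [rat_of_code] and is never reduced, so arithmetic stays polynomial
    in the three numbers and comparison is cross multiplication. *)
Definition rcmp (F : E -> rat) : Prop := exists X Y Z,
  [/\ cmp o vs X, cmp o vs Y, cmp o vs Z &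
   forall x, F x = ((X x)%:R - (Y x)%:R) / (Z x).+1%:R].

Lemma rat_codeE c :
  rat_of_code c = ((cnth c 0)%:R - (cnth c 1)%:R) / (cnth c 2).+1%:R.
Proof. by []. Qed.

Lemma rcmp_code A : cmp o vs A -> rcmp (fun x => rat_of_code (A x)).
Proof.
move=> cA; exists (fun x => cnth (A x) 0), (fun x => cnth (A x) 1),
  (fun x => cnth (A x) 2); split=> [|||x]; last exact: rat_codeE.
all: by apply: cmp_cnth; cmp_leaf.
Qed.

Lemma rcmp_ratseq A B : cmp o vs A -> cmp o vs B ->
  rcmp (fun x => ratseq_of_code (A x) (B x)).
Proof. by move=> cA cB; apply: rcmp_code; apply: cmp_cnth. Qed.

Lemma rcmp_nat A : cmp o vs A -> rcmp (fun x => (A x)%:R).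
Proof.
move=> cA; exists A, (fun=> 0%N), (fun=> 0%N).
by split=> // [||x]; [cmp_leaf|cmp_leaf|rewrite subr0 divr1].
Qed.

Lemma rcmp_inv A : cmp o vs A -> rcmp (fun x => (A x).+1%:R^-1).
Proof.
move=> cA; exists (fun=> 1%N), (fun=> 0%N), A.
by split=> // [||x]; [cmp_leaf|cmp_leaf|rewrite subr0 mul1r].
Qed.

Lemma rcmp_half A : cmp o vs A -> rcmp (fun x => 2^-1 ^+ A x).
Proof.
move=> cA; have cB : cmp o vs (fun x => (2 ^ A x).-1).
  by apply: cmp_pred; apply: cmp_exp; cmp_leaf.
have [X [Y [Z [? ? ? h]]]] := rcmp_inv cB; exists X, Y, Z; split=> // x.
by rewrite -h prednK ?expn_gt0 // exprVn natrX.
Qed.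

Lemma rcmp_add F G : rcmp F -> rcmp G -> rcmp (fun x => F x + G x).
Proof.
move=> [X [Y [Z [cX cY cZ hF]]]] [X' [Y' [Z' [cX' cY' cZ' hG]]]].
exists (fun x => X x * (Z' x).+1 + X' x * (Z x).+1)%N,
  (fun x => Y x * (Z' x).+1 + Y' x * (Z x).+1)%N,
  (fun x => ((Z x).+1 * (Z' x).+1).-1)%N; split.
- by apply: cmp_add; apply: cmp_mul => //; apply: cmp_S.
- by apply: cmp_add; apply: cmp_mul => //; apply: cmp_S.
- by apply: cmp_pred; apply: cmp_mul; apply: cmp_S.
- move=> x; rewrite hF hG prednK // !natrD !natrM.
  have : (Z x).+1%:R != 0 :> rat by rewrite pnatr_eq0.
  have : (Z' x).+1%:R != 0 :> rat by rewrite pnatr_eq0.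
  by move: (Z x).+1%:R (Z' x).+1%:R => z z' z0 z0'; field; apply/andP.
Qed.

Lemma rcmp_opp F : rcmp F -> rcmp (fun x => - F x).
Proof.
move=> [X [Y [Z [cX cY cZ hF]]]]; exists Y, X, Z; split=> // x.
by rewrite hF -mulNr opprB.
Qed.

Lemma rcmp_sub F G : rcmp F -> rcmp G -> rcmp (fun x => F x - G x).
Proof. by move=> cF cG; apply: rcmp_add => //; apply: rcmp_opp. Qed.

Lemma rcmp_mul F G : rcmp F -> rcmp G -> rcmp (fun x => F x * G x).
Proof.
move=> [X [Y [Z [cX cY cZ hF]]]] [X' [Y' [Z' [cX' cY' cZ' hG]]]].
exists (fun x => X x * X' x + Y x * Y' x)%N,
  (fun x => X x * Y' x + Y x * X' x)%N,
  (fun x => ((Z x).+1 * (Z' x).+1).-1)%N; split.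
- by apply: cmp_add; apply: cmp_mul.
- by apply: cmp_add; apply: cmp_mul.
- by apply: cmp_pred; apply: cmp_mul; apply: cmp_S.
- move=> x; rewrite hF hG prednK // !natrD !natrM.
  have : (Z x).+1%:R != 0 :> rat by rewrite pnatr_eq0.
  have : (Z' x).+1%:R != 0 :> rat by rewrite pnatr_eq0.
  by move: (Z x).+1%:R (Z' x).+1%:R => z z' z0 z0'; field; apply/andP.
Qed.

Lemma bcmp_le F G : rcmp F -> rcmp G -> bcmp o vs (fun x => F x <= G x).
Proof.
move=> [X [Y [Z [cX cY cZ hF]]]] [X' [Y' [Z' [cX' cY' cZ' hG]]]].
apply: (@eq_cmp _ _ _ (fun x => (X x * (Z' x).+1 + Y' x * (Z x).+1 <=
   X' x * (Z x).+1 + Y x * (Z' x).+1)%N : nat)).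
  move=> x; rewrite hF hG ler_pdivrMr // mulrAC ler_pdivlMr //.
  by rewrite !mulrBl lerBlDr addrAC lerBrDr -!natrM -!natrD ler_nat.
apply: bcmp_leq; apply: cmp_add; apply: cmp_mul => //; exact: cmp_S.
Qed.

Lemma bcmp_lt F G : rcmp F -> rcmp G -> bcmp o vs (fun x => F x < G x).
Proof.
by move=> cF cG; apply: eq_cmp (bcmp_not (bcmp_le cG cF)) => x; rewrite ltNge.
Qed.

Lemma rcmp_if P F G : bcmp o vs P -> rcmp F -> rcmp G ->
  rcmp (fun x => if P x then F x else G x).
Proof.
move=> cP [X [Y [Z [cX cY cZ hF]]]] [X' [Y' [Z' [cX' cY' cZ' hG]]]].
exists (fun x => if P x then X x else X' x),
  (fun x => if P x then Y x else Y' x), (fun x => if P x then Z x else Z' x).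
by split; try (exact: cmp_if); move=> x; case: (P x).
Qed.

Lemma rcmp_norm F : rcmp F -> rcmp (fun x => `|F x|).
Proof.
move=> cF; have := rcmp_if (bcmp_le (rcmp_nat (cmp_const o vs 0)) cF) cF (rcmp_opp cF).
move=> [X [Y [Z [? ? ? h]]]]; exists X, Y, Z; split=> // x.
by rewrite -h; case: ger0P.
Qed.

Lemma rcmp_clip F : rcmp F -> rcmp (fun x => Num.min 1 (Num.max 0 (F x))).
Proof.
move=> cF; have c0 := rcmp_nat (cmp_const o vs 0); have c1 := rcmp_nat (cmp_const o vs 1).
have cM := rcmp_if (bcmp_lt c0 cF) cF c0.
have [X [Y [Z [? ? ? h]]]] := rcmp_if (bcmp_lt c1 cM) c1 cM.
by exists X, Y, Z; split=> // x; rewrite -h.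
Qed.
End RationalClosure.

(** The common denominator is the running product of the denominators, which turns a sum of variable
    length into two primitive recursions for the numerators. *)
Lemma sum_fraction (X Y Z : nat -> nat) n :
  \sum_(i < n) (((X i)%:R - (Y i)%:R) / (Z i).+1%:R : rat) =
  ((iteri n (fun i a => a * (Z i).+1 + X i * iteri i (fun j b => b * (Z j).+1) 1) 0)%N%:R
   - (iteri n (fun i a => a * (Z i).+1 + Y i * iteri i (fun j b => b * (Z j).+1) 1) 0)%N%:R)
  / (iteri n (fun j b => b * (Z j).+1) 1)%N.-1.+1%:R.
Proof.
have D0 m : (0 < iteri m (fun j b => b * (Z j).+1) 1)%N.
  by elim: m => //= m IH; rewrite muln_gt0 IH.
elim: n => [|n IH]; first by rewrite big_ord0 /= subrr mul0r.
rewrite big_ord_recr IH /= !prednK ?D0 ?muln_gt0 ?D0 //.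
have := D0 n; move: (iteri n _ 1%N) => D hD.
have : (Z n).+1%:R != 0 :> rat by rewrite pnatr_eq0.
have : D%:R != 0 :> rat by rewrite pnatr_eq0 -lt0n.
rewrite !natrD !natrM; move: (Z n).+1%:R D%:R => z d d0 z0; field.
by apply/andP.
Qed.

Lemma rcmp_sum E (o : E -> nat -> nat) vs (N : E -> nat) (F : nat -> E -> rat) :
  cmp o vs N -> rcmp (oext o) (ext vs) (fun y => F y.1 y.2) ->
  rcmp o vs (fun x => \sum_(i < N x) F i x).
Proof.
move=> cN [X [Y [Z [cX cY cZ hF]]]].
pose D n x := iteri n (fun j b => b * (Z (j, x)).+1)%N 1%N.
have mid (G : nat * E -> nat) : cmp (oext o) (ext vs) G ->
    cmp (oext (oext o)) (ext (ext vs)) (fun y => G (y.1, y.2.2)).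
  move=> cG; apply: (@cmp_ext_weak _ _ _ (fun i x => G (i, x))).
  by apply: eq_cmp cG => -[].
(* Stated over any [E'] because the product is used both at the outer state and under the binder of
   the numerators. *)
have cD E' (o' : E' -> nat -> nat) vs' (h : E' -> E) (M : E' -> nat) :
    (forall G, cmp (oext o) (ext vs) G ->
       cmp (oext o') (ext vs') (fun y => G (y.1, h y.2))) ->
    cmp o' vs' M -> cmp o' vs' (fun y => D (M y) (h y)).
  move=> hG cM; apply: (cmp_rec (S := fun j b y => b * (Z (j, h y)).+1)%N) => //.
    exact: cmp_const.
  apply: cmp_mul; first by cmp_leaf.
  by apply: cmp_S; apply: (@cmp_ext_weak _ _ _ (fun j y => Z (j, h y))); apply: hG.
have id_ext G : cmp (oext o) (ext vs) G -> cmp (oext o) (ext vs) (fun y => G (y.1, y.2)).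
  by move=> cG; apply: eq_cmp cG => -[].
have num (G : nat * E -> nat) : cmp (oext o) (ext vs) G ->
    cmp o vs (fun x => iteri (N x) (fun i a => a * (Z (i, x)).+1 + G (i, x) * D i x)%N 0%N).
  move=> cG; apply: (cmp_rec (S := fun i a x => a * (Z (i, x)).+1 + G (i, x) * D i x)%N) => //.
    exact: cmp_const.
  apply: cmp_add; apply: cmp_mul; [by cmp_leaf|by apply: cmp_S; apply: mid|by apply: mid|].
  apply: (@cmp_ext_weak _ _ _ (fun j y => D j y)).
  apply: (cD _ _ _ snd fst); last by cmp_leaf.
  by move=> G' /mid.
exists (fun x => iteri (N x) (fun i a => a * (Z (i, x)).+1 + X (i, x) * D i x)%N 0%N),
  (fun x => iteri (N x) (fun i a => a * (Z (i, x)).+1 + Y (i, x) * D i x)%N 0%N),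
  (fun x => (D (N x) x).-1); split; try exact: num.
  by apply: cmp_pred; apply: (cD _ _ _ id).
move=> x; rewrite -sum_fraction; apply: eq_bigr => i _; exact: (hF (val i, x)).
Qed.

(** * The Hilbert cube *)

Section HilbertCube.
Context {R : realType}.
Implicit Types (x y z : {ptws nat -> R}) (A P : set {ptws nat -> R}).

Local Notation half n := (2^-1 ^+ n : R).
Local Notation cube := (@hilbert_cube R).
Local Notation d := (@cube_dist R).

Lemma half_gt0 n : 0 < half n.
Proof. by rewrite exprn_gt0 // invr_gt0. Qed.

Lemma halfS n : half n = half n.+1 + half n.+1.
Proof. by rewrite exprS -mulrDl [X in X * _](_ : _ = 1) ?mul1r //; lra. Qed.

Lemma half_le m n : (m <= n)%N -> half n <= half m.
Proof. by move=> h; rewrite ler_wiXn2l //; lra. Qed.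

Lemma exists_half_lt (e : R) : 0 < e -> exists n, half n < e.
Proof.
move=> e0; have [n _ hn] := near_infty_natSinv_expn_lt (PosNum e0).
by exists n; have := hn n (leqnn n); rewrite /= div1r exprVn.
Qed.

Lemma ler_add_half (a b : R) : (forall n, a <= b + half n) -> a <= b.
Proof.
move=> h; rewrite leNgt; apply/negP => ba.
have [n hn] := @exists_half_lt (a - b) ltac:(by rewrite subr_gt0).
by have := h n; lra.
Qed.

Definition cube_psum n x y : R := \sum_(l < n) `|x l - y l| * half l.+1.

Lemma sum_half n : \sum_(l < n) half l.+1 = 1 - half n.
Proof.
elim: n => [|n IH]; first by rewrite big_ord0 expr0 subrr.
by rewrite big_ord_recr IH /= [in X in X + _](halfS n); lra.
Qed.

Lemma cube_psum_series x y n :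
  series (fun l => `|x l - y l| / 2 ^+ l.+1) n = cube_psum n x y.
Proof. by rewrite /series /= big_mkord; apply: eq_bigr => i _; rewrite exprVn. Qed.

Lemma cube_psum_mono x y n m : (n <= m)%N -> cube_psum n x y <= cube_psum m x y.
Proof.
move=> /subnK <-; elim: (m - n)%N => //= k IH; apply: (le_trans IH).
rewrite addSn /cube_psum big_ord_recr /= lerDl.
by rewrite mulr_ge0 // ltW // half_gt0.
Qed.

Lemma cube_coord_le1 x y l : cube x -> cube y -> `|x l - y l| <= 1.
Proof. by move=> /(_ l)/andP[? ?] /(_ l)/andP[? ?]; rewrite ler_norml; lra. Qed.

Lemma cube_psum_tail x y n m : cube x -> cube y ->
  cube_psum m x y <= cube_psum n x y + half n.
Proof.
move=> cx cy; have [mn|/ltnW nm] := leqP m n.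
  by have := cube_psum_mono x y mn; have := half_gt0 n; lra.
(* A partial sum plus its own tail bound is nonincreasing, since the term of index [m] is at most
   [half m.+1 = half m - half m.+1]. *)
suff: cube_psum m x y + half m <= cube_psum n x y + half n by have := half_gt0 m; lra.
rewrite -(subnK nm); elim: (m - n)%N => [|k IH] //=.
apply: le_trans IH; rewrite addSn /cube_psum big_ord_recr /= [half (k + n)]halfS.
have := cube_coord_le1 (k + n) cx cy; have := half_gt0 (k + n).+1.
by move: (half _) => h h0 h1; nra.
Qed.

Lemma cube_series_cvg x y : cube x -> cube y ->
  cvgn (series (fun l => `|x l - y l| / 2 ^+ l.+1)).
Proof.
move=> cx cy; apply: nondecreasing_is_cvgn.
  by move=> n m nm; rewrite !cube_psum_series; apply: cube_psum_mono.
exists 1 => _ [n _ <-]; rewrite cube_psum_series.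
apply: (le_trans (cube_psum_tail 0 n cx cy)).
by rewrite /cube_psum big_ord0 add0r expr0.
Qed.

Lemma cube_psum_le x y n : cube x -> cube y -> cube_psum n x y <= d x y.
Proof.
move=> cx cy; rewrite -cube_psum_series; apply: nondecreasing_cvgn_le.
  by move=> k m km; rewrite !cube_psum_series; apply: cube_psum_mono.
exact: cube_series_cvg.
Qed.

(** With [cube_psum_le] this squeezes the distance between finite sums; the metric laws then follow
    from [ler_add_half] without limits. *)
Lemma cube_dist_le x y n : cube x -> cube y -> d x y <= cube_psum n x y + half n.
Proof.
move=> cx cy; apply: limr_le; first exact: cube_series_cvg.
by apply: nearW => m; rewrite cube_psum_series; apply: cube_psum_tail.
Qed.

Lemma cube_dist_ge0 x y : cube x -> cube y -> 0 <= d x y.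
Proof.
by move=> cx cy; have := cube_psum_le 0 cx cy; rewrite /cube_psum big_ord0.
Qed.

Lemma cube_distC x y : d x y = d y x.
Proof.
rewrite /cube_dist; congr (limn (series _)); apply/funext => l.
by rewrite distrC.
Qed.

Lemma cube_distD y x z : cube x -> cube y -> cube z -> d x z <= d x y + d y z.
Proof.
move=> cx cy cz; apply: ler_add_half => n.
apply: (le_trans (cube_dist_le n cx cz)); rewrite lerD2r.
apply: le_trans (lerD (cube_psum_le n cx cy) (cube_psum_le n cy cz)).
rewrite /cube_psum -big_split; apply: ler_sum => l _ /=.
by rewrite -mulrDl ler_wpM2r ?ler_distD // ltW // half_gt0.
Qed.

Lemma cube_distxx x : cube x -> d x x = 0.
Proof.
move=> cx; apply/eqP; rewrite eq_le cube_dist_ge0 // andbT.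
apply: ler_add_half => n; apply: (le_trans (cube_dist_le n cx cx)).
by rewrite lerD2r /cube_psum big1 // => l _; rewrite subrr normr0 mul0r.
Qed.

Lemma cube_coord_dist x y l : cube x -> cube y -> `|x l - y l| * half l.+1 <= d x y.
Proof.
move=> cx cy; apply: le_trans (cube_psum_le l.+1 cx cy).
rewrite /cube_psum big_ord_recr /= lerDr; apply: sumr_ge0 => i _.
by rewrite mulr_ge0 // ltW // half_gt0.
Qed.

Lemma cube_dist_eq0 x y : cube x -> cube y -> d x y <= 0 -> x = y.
Proof.
move=> cx cy dxy; apply/funext => l; apply/eqP; rewrite -subr_eq0 -normr_le0.
have := cube_coord_dist l cx cy; have := half_gt0 l.+1.
by move: (half _) => h h0 h1; nra.
Qed.

Definition qcoord k l : rat := Num.min 1 (Num.max 0 (ratseq_of_code k l)).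
(** The distance of two dense points is an exact rational: a list coded by [k] has at most [k]
    entries, so all coordinates from [a + b] on vanish. This makes comparisons of such distances
    decidable. *)
Definition qdist a b : rat :=
  \sum_(l < a + b) `|qcoord a l - qcoord b l| * 2^-1 ^+ l.+1.

Lemma cube_denseE k l : cube_dense k l = ratr (qcoord k l) :> R.
Proof. by []. Qed.

Lemma cube_dense_cube k : cube (cube_dense k).
Proof.
move=> l; rewrite cube_denseE ler0q.
have /andP[-> h1] : 0 <= qcoord k l <= 1.
  by rewrite /qcoord le_min ler01 le_max lexx ge_min lexx.
by move: h1; rewrite -(ler_rat R) rmorph1.
Qed.

Lemma size_decode k : (size (CodeSeq.decode k) <= k)%N.
Proof.
rewrite -{2}(CodeSeq.decodeK k); elim: (CodeSeq.decode k) => //= x s IH.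
have : (0 < 2 ^ x)%N by rewrite expn_gt0.
by move: (2 ^ x)%N (CodeSeq.code s) IH => a b; nia.
Qed.

Lemma qcoord_big k l : (k <= l)%N -> qcoord k l = 0.
Proof.
move=> kl; rewrite /qcoord /ratseq_of_code nth_default; last first.
  exact: leq_trans (size_decode k) kl.
by rewrite /rat_of_code /= subr0 mul0r maxxx min_r.
Qed.

Lemma cube_dist_dense a b : d (cube_dense a) (cube_dense b) = ratr (qdist a b).
Proof.
have S n : (a + b <= n)%N -> cube_psum n (cube_dense a) (cube_dense b) = ratr (qdist a b).
  move=> /subnK <-; elim: (n - _)%N => [|k IH] /=; last first.
    rewrite addSn /cube_psum big_ord_recr /= -/(cube_psum _ _ _) IH.
    by rewrite !cube_denseE !qcoord_big ?subrr ?normr0 ?mul0r ?addr0 //; lia.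
  rewrite /cube_psum rmorph_sum; apply: eq_bigr => l _ /=.
  rewrite !cube_denseE -rmorphB rmorphM rmorphXn /=; by rewrite ratr_norm fmorphV /= ratr_nat.
have ca := cube_dense_cube a; have cb := cube_dense_cube b.
apply/eqP; rewrite eq_le; apply/andP; split.
  apply: ler_add_half => n; apply: le_trans (cube_dist_le (a + b + n) ca cb) _.
  by rewrite S ?leq_addr // lerD2l half_le // leq_addl.
by rewrite -(S _ (leqnn _)); apply: cube_psum_le.
Qed.

(** This is the code of [n] copies of [E], the largest code of a list of that length with entries at
    most [E]. *)
Definition code_bound E n := iteri n (fun _ b => 2 ^ E * b.*2.+1)%N 0%N.

Lemma code_le_bound E s : all (fun i => i <= E)%N s ->
  (CodeSeq.code s <= code_bound E (size s))%N.
Proof.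
elim: s => //= x s IH /andP[xE /IH h].
by apply: leq_mul; [rewrite leq_exp2l|rewrite ltnS leq_double].
Qed.

(** The codes below it include every point whose first [t + 1] coordinates are multiples
    [k / 2 ^ (t + 1)] in the unit interval, each written as a triple of entries at most
    [2 ^ (t + 1)], and whose other coordinates are 0. *)
Definition dense_bound t :=
  (code_bound (code_bound (2 ^ t.+1) 3) t.+1).+1.

Lemma cube_dense_near x t : cube x ->
  exists2 a, (a < dense_bound t)%N & d x (cube_dense a) <= half t.
Proof.
move=> cx; pose M := t.+1.
pose c l := Num.trunc (x l * 2 ^+ M).
have cP l : (c l)%:R * half M <= x l < (c l).+1%:R * half M.
  have := @truncn_itv R (x l * 2 ^+ M).
  rewrite -/(c l) exprVn ler_pdivrMr ?exprn_gt0 // ltr_pdivlMr ?exprn_gt0 //; apply.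
  by rewrite mulr_ge0 // ?exprn_ge0 //; case/andP: (cx l).
have cM l : (c l <= 2 ^ M)%N.
  rewrite -(ler_nat R) natrX; have /andP[h _] := cP l; have /andP[_ x1] := cx l.
  by have := le_trans h x1; rewrite exprVn ler_pdivrMr ?exprn_gt0 // mul1r.
pose w l := CodeSeq.code [:: c l; 0%N; (2 ^ M).-1].
pose a := CodeSeq.code (mkseq w M); exists a.
  rewrite ltnS /a -[X in code_bound _ X](size_mkseq w M); apply: code_le_bound.
  apply/allP => _ /mapP[l _ ->]; apply: (@code_le_bound (2 ^ M) [:: _; _; _]) => /=.
  by rewrite cM leq_pred.
have qa l : (l < M)%N -> qcoord a l = (c l)%:R * 2^-1 ^+ M.
  move=> lM; rewrite /qcoord /ratseq_of_code /a CodeSeq.codeK nth_mkseq // /w.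
  rewrite /rat_of_code CodeSeq.codeK /= subr0 prednK ?expn_gt0 // natrX exprVn.
  have h0 : 0 <= (c l)%:R / 2 ^+ M :> rat by rewrite divr_ge0 // exprn_ge0.
  rewrite (max_r h0) min_r // ler_pdivrMr ?exprn_gt0 // mul1r -natrX ler_nat.
  exact: cM.
(* One half of [half t] pays for the coordinates from [M] on, the other for rounding down the first
   [M]. *)
apply: (le_trans (cube_dist_le M cx (cube_dense_cube a))).
rewrite [leRHS]halfS lerD2r.
apply: (@le_trans _ _ (\sum_(l < M) half M * half l.+1)).
  apply: ler_sum => l _; rewrite ler_wpM2r ?(ltW (half_gt0 _)) //.
  rewrite cube_denseE qa // rmorphM rmorphXn /= fmorphV /= !ratr_nat.
  have /andP[h1 h2] := cP l; move: h2; rewrite -natr1 mulrDl mul1r => h2.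
  by rewrite ger0_norm ?subr_ge0 // lerBlDl ltW.
rewrite -mulr_sumr sum_half; have := half_gt0 M.
by move: (half M) => h h0; nra.
Qed.

(** * Topology and compactness of the cube *)

Definition cube_box y M (e : R) : set {ptws nat -> R} :=
  [set z | forall l, (l < M)%N -> `|z l - y l| < e].

Lemma open_cube_box y M e : open (cube_box y M e).
Proof.
elim: M => [|M IH].
  have -> : cube_box y 0 e = setT by apply/seteqP; split.
  exact: openT.
have -> : cube_box y M.+1 e = cube_box y M e `&` (fun z => z M) @^-1` ball (y M) e;
  last first.
  apply: openI => //; apply: open_comp; last exact: ball_open.
  by move=> z _; apply: (@proj_continuous nat (fun=> R) M).
apply/seteqP; split => z /= h.
  by split=> [l lM|]; [apply: h; apply: ltnW|rewrite /ball /= distrC; apply: h].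
move: h => [h1]; rewrite /ball /= distrC => h2 l; rewrite ltnS leq_eqVlt.
by move=> /orP[/eqP ->|/h1].
Qed.

Lemma cube_box_dist y z M e : cube y -> cube z -> 0 < e -> cube_box y M e z ->
  d z y <= e + half M.
Proof.
move=> cy cz e0 h; apply: (le_trans (cube_dist_le M cz cy)); rewrite lerD2r.
apply: (@le_trans _ _ (\sum_(l < M) e * half l.+1)).
  by apply: ler_sum => l _; rewrite ler_wpM2r ?(ltW (half_gt0 _)) // ltW // h.
rewrite -mulr_sumr sum_half; have := half_gt0 M.
by move: (half M) => k h0; nra.
Qed.

Lemma cube_box_near y M e : cube y -> 0 < e ->
  exists2 r, 0 < r & forall z, cube z -> d z y < r -> cube_box y M e z.
Proof.
move=> cy e0; exists (e * half M); first by rewrite mulr_gt0 // half_gt0.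
move=> z cz dzy l lM; have := le_lt_trans (cube_coord_dist l cz cy) dzy.
have := half_le lM; have := half_gt0 l.+1; move: (half l.+1) (half M) => h k h0 kh dlt.
by rewrite -(ltr_pM2r h0); apply: lt_le_trans dlt _; rewrite ler_pM2l.
Qed.

(** Otherwise points of the cube outside [V] approach [x] in distance, hence coordinatewise, hence
    in the pointwise topology, against openness. *)
Lemma open_cube_dist (V : set {ptws nat -> R}) x : open V -> cube x -> V x ->
  exists2 r, 0 < r & forall z, cube z -> d z x < r -> V z.
Proof.
move=> oV cx Vx; apply: contrapT => nr.
have ex n : exists z, [/\ cube z, d z x < half n & ~ V z].
  apply: contrapT => nz; apply: nr; exists (half n); first exact: half_gt0.
  by move=> z cz dz; apply: contrapT => nVz; apply: nz; exists z.
have [u hu] := choice ex.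
have ux : u @ \oo --> x.
  apply/pointwise_cvgP => l; apply/cvgrPdist_lt => e e0.
  have [r r0 hr] := cube_box_near l.+1 cx e0.
  have [n hn] := exists_half_lt r0; exists n => // m /= nm.
  have [cu du _] := hu m; rewrite distrC; apply: hr => //.
  by apply: lt_trans du _; apply: le_lt_trans hn; apply: half_le.
have : nbhs x V by apply: open_nbhs_nbhs.
move=> /ux[n _ /(_ n (leqnn n))] /=.
by have [_ _ ] := hu n.
Qed.

Lemma compact_hilbert_cube : compact cube.
Proof.
have := @tychonoff nat (fun=> R) (fun=> `[0, 1]%classic) (fun=> @segment_compact R 0 1).
by congr compact; apply/seteqP; split => z h l; have := h l; rewrite /= in_itv.
Qed.

(** Closedness relative to the cube, phrased by distances, which behave as a metric only there. *)
Definition cube_closed A := forall x, cube x -> ~ A x ->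
  exists2 r, 0 < r & forall z, cube z -> d z x < r -> ~ A z.

(** Compactness with a radius depending on the centre; [r] need be neither continuous nor bounded
    below. The neighbourhood of a point outside [A] is chosen to miss [A], so only centres in [A]
    serve points of [A]. *)
Lemma finite_net A (r : {ptws nat -> R} -> R) :
  A `<=` cube -> cube_closed A -> (forall x, A x -> 0 < r x) ->
  exists ys : seq {ptws nat -> R}, (forall y, y \in ys -> A y) /\
    forall x, A x -> exists2 y, y \in ys & d x y < r y.
Proof.
move=> Ac clA r0.
have ex y : exists U : set {ptws nat -> R}, cube y -> [/\ open U, U y &
    forall z, cube z -> U z -> A z -> A y /\ d z y < r y].
  have [cy|] := pselect (cube y); last by exists setT.
  have [e [e0 he]] : exists e, 0 < e /\
      forall z, cube z -> d z y < e -> A z -> A y /\ d z y < r y.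
    have [Ay|nAy] := pselect (A y).
      by exists (r y); split=> [|z cz dz _]; [exact: r0|].
    have [e e0 he] := clA y cy nAy; exists e; split=> // z cz dz Az.
    by have := he z cz dz.
  have [M hM] := @exists_half_lt (e / 2) ltac:(lra).
  exists (cube_box y M (e / 2)) => _; split=> //.
  - exact: open_cube_box.
  - by move=> l _; rewrite subrr normr0; lra.
  - move=> z cz Uz; apply: he => //.
    have := cube_box_dist cy cz _ Uz; lra.
have [U hU] := choice ex.
(* Along the filter of ever larger finite lists of centres, every point is eventually covered
   locally; near-covering compactness yields one list for the whole cube. *)
pose F := filter_from [set: seq {ptws nat -> R}] (fun ys =>
  [set zs : seq {ptws nat -> R} | {subset ys <= zs}]).
have FF : Filter F.
  apply: filter_from_filter; first by exists [::].
  move=> ys zs _ _; exists (ys ++ zs) => // ws h.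
  by split=> z zin; apply: h; rewrite mem_cat zin ?orbT.
have /compact_near_coveringP := compact_hilbert_cube.
move=> /(_ _ F (fun zs x => exists2 y, y \in zs /\ cube y & U y x) FF).
case=> [x cx|zs _ /(_ zs) cov].
  have [oU Ux _] := hU x cx.
  exists (U x, [set zs : seq {ptws nat -> R} | {subset [:: x] <= zs}]) => /=.
    by split; [apply: open_nbhs_nbhs|exists [:: x]].
  by move=> [z zs] /= [Uz h]; exists x => //; split=> //; apply: h; rewrite inE.
exists [seq y <- zs | `[< A y >]]; split.
  by move=> y; rewrite mem_filter => /andP[/asboolP].
move=> x Ax; have [//|y [yin cy] Uyx] := cov _ x (Ac x Ax).
have [_ _ /(_ x (Ac x Ax) Uyx Ax)[Ay dxy]] := hU y cy.
by exists y => //; rewrite mem_filter; apply/andP; split=> //; apply/asboolP.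
Qed.

(** A Lebesgue number principle: a gap available locally, and inherited by smaller gaps, can be
    chosen uniformly as the minimum over a finite net. *)
Lemma cube_uniform A (Good : R -> {ptws nat -> R} -> Prop) :
  A `<=` cube -> cube_closed A ->
  (forall g g' x, g' <= g -> Good g x -> Good g' x) ->
  (forall x, A x -> exists2 g, 0 < g & forall z, A z -> d z x < g -> Good g z) ->
  exists2 g, 0 < g & forall x, A x -> Good g x.
Proof.
move=> Ac clA mono loc.
have ex x : exists g, 0 < g /\ (A x -> forall z, A z -> d z x < g -> Good g z).
  have [Ax|nA] := pselect (A x); last by exists 1.
  by have [g g0 hg] := loc x Ax; exists g.
have [r hr] := choice ex.
have [ys [ysA cov]] := @finite_net A r Ac clA (fun x _ => (hr x).1).
have [g g0 hg] : exists2 g, 0 < g & forall y, y \in ys -> g <= r y.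
  elim: ys {ysA cov} => [|y ys [g g0 hg]]; first by exists 1.
  exists (Num.min g (r y)); first by rewrite lt_min g0 (hr y).1.
  by move=> z; rewrite inE ge_min => /orP[/eqP ->|/hg ->] //; rewrite lexx orbT.
exists g => // x Ax; have [y yin dxy] := cov x Ax.
by apply: mono (hg y yin) _; apply: (hr y).2 => //; apply: ysA.
Qed.

Lemma cube_closed_cube : cube_closed cube.
Proof. by move=> x cx /(_ cx). Qed.

(** The cover to be refined consists of coordinate boxes, not metric balls, because its members must
    be open in the ambient space, beyond the cube. *)
Lemma fine_cover P n (e : R) : P `<=` cube -> cube_closed P ->
  covering_dim_lt P n.+1 -> 0 < e ->
  exists b (V : 'I_b -> set {ptws nat -> R}),
    [/\ forall j, open (V j), P `<=` \bigcup_j V j,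
      forall j x z, P x -> P z -> V j x -> V j z -> d x z < e &
      forall x, P x -> (#|[pred j : 'I_b | `[< V j x >]]| <= n.+1)%N].
Proof.
move=> Pc clP dimP e0.
(* A box point is within [e / 8 + half M < e / 4] of the centre, so two of them are within
   [e / 2]. *)
have [M hM] := @exists_half_lt (e / 8) ltac:(lra).
pose U y := cube_box y M (e / 8).
have ex y : exists r, 0 < r /\ (P y -> forall z, cube z -> d z y < r -> U y z).
  have [Py|] := pselect (P y); last by exists 1.
  have [r r0 hr] := @cube_box_near y M (e / 8) (Pc y Py) ltac:(lra).
  by exists r.
have [r hr] := choice ex.
have [ys [ysP cov]] := @finite_net P r Pc clP (fun x _ => (hr x).1).
have [] := dimP (size ys) (fun i => U (tnth (in_tuple ys) i)).
- by move=> i; apply: open_cube_box.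
- move=> x Px; have [y yin dxy] := cov x Px.
  have iin : (index y ys < size ys)%N by rewrite index_mem.
  exists (Ordinal iin) => //.
  rewrite (tnth_nth y) /= nth_index //; apply: (hr y).2 => //; [exact: ysP|exact: Pc].
move=> b [V [oV covV small ordV]]; exists b, V; split=> // j x z Px Pz Vx Vz.
have [i hi] := small j; set y := tnth _ i in hi.
have cy : cube y by apply/Pc/ysP; apply: mem_tnth.
have := @cube_box_dist y x M (e / 8) cy (Pc x Px) ltac:(lra) (hi x (conj Px Vx)).
have := @cube_box_dist y z M (e / 8) cy (Pc z Pz) ltac:(lra) (hi z (conj Pz Vz)).
have := cube_distD (Pc x Px) cy (Pc z Pz); rewrite (cube_distC y z).
by lra.
Qed.

End HilbertCube.

(** * General position *)

Section GeneralPosition.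
Context {R : realFieldType}.

Lemma exists_kernel_col p k (A : 'M[R]_(p, k)) :
  (p < k)%N -> exists2 c : 'cV[R]_k, c != 0 & A *m c = 0.
Proof.
move=> pk; have : kermx A^T != 0.
  rewrite -mxrank_eq0 mxrank_ker subn_eq0 -ltnNge mxrank_tr.
  exact: leq_ltn_trans (rank_leq_row A) pk.
case/rowV0Pn => c /sub_kermxP cA c0; exists c^T.
  by rewrite -(inj_eq trmx_inj) trmxK trmx0.
by apply: trmx_inj; rewrite trmx_mul trmxK cA trmx0.
Qed.

Lemma exists_nonroot (p : {poly R}) : p != 0 -> exists2 t, 0 < t < 1 & ~~ root p t.
Proof.
(* These are [size p] distinct candidates in the open unit interval, more than [p] has roots. *)
move=> p0; pose rs := [seq (i.+2%:R : R)^-1 | i <- iota 0 (size p)].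
have [/(max_poly_roots p0) h|] := boolP (all (root p) rs).
  have : (size rs < size p)%N.
    apply: h; rewrite map_inj_uniq ?iota_uniq // => i j /invr_inj /eqP.
    by rewrite eqr_nat => /eqP[].
  by rewrite size_map size_iota ltnn.
rewrite -has_predC => /hasP[_ /mapP[i _ ->] /= h]; exists (i.+2%:R^-1) => //.
by rewrite invr_gt0 ltr0n /= invf_lt1 ?ltr0n // ltr1n.
Qed.

(** The moment curve through [z] meets each of finitely many hyperplanes
    finitely often. *)
Lemma avoid_hyperplanes m (ws : seq 'cV[R]_(1 + m)) (z : 'rV[R]_m) (e : R) :
  0 < e -> (forall w, w \in ws -> w != 0) ->
  exists2 v : 'rV[R]_m, (forall l, `|v 0 l - z 0 l| < e) &
    forall w, w \in ws -> (row_mx 1%:M v : 'rV_(1 + m)) *m w != 0.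
Proof.
move=> e0 ws0; have e20 : e / 2 != 0 by rewrite lt0r_neq0 // divr_gt0.
(* [P w] is the pairing of [w] with the point [v l = z l + e / 2 * t ^ l.+1] of the curve, as a
   polynomial in [t], and [a w] is its constant term. If it vanishes, its higher coefficients give
   all entries of [w] but the first, and then [a w] gives that one. *)
pose a (w : 'cV[R]_(1 + m)) := w (lshift m 0) 0 + \sum_(l < m) z 0 l * w (rshift 1 l) 0.
pose P (w : 'cV[R]_(1 + m)) :=
  (a w)%:P + \sum_(l < m) (e / 2 * w (rshift 1 l) 0) *: 'X^(l.+1).
have P0 w : w != 0 -> P w != 0.
  apply: contra_neq => Pw0.
  have wl l : w (rshift 1 l) 0 = 0.
    have := congr1 (fun p : {poly R} => p`_l.+1) Pw0.
    rewrite /P coefD coefC coef_sum coef0 add0r (bigD1 l) //= big1 => [|i il].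
      rewrite addr0 coefZ coefXn eqxx mulr1 => /eqP.
      by rewrite mulf_eq0 (negPf e20) => /eqP.
    by rewrite coefZ coefXn eqSS (inj_eq val_inj) eq_sym (negPf il) mulr0.
  have w0 : w (lshift m 0) 0 = 0.
    have := congr1 (fun p : {poly R} => p`_0) Pw0.
    rewrite /P coefD coefC coef_sum coef0 /= big1 => [|i _]; last first.
      by rewrite coefZ coefXn mulr0.
    by rewrite addr0 /a big1 ?addr0 // => l _; rewrite wl mulr0.
  apply/colP => i; rewrite mxE; case: (split_ordP i) => j ->; last exact: wl.
  by rewrite (ord1 j).
have : \prod_(w <- ws) P w != 0.
  by rewrite prodf_seq_neq0; apply/allP => w /ws0 /P0.
move=> /exists_nonroot[t /andP[t0 t1] nr].
pose v : 'rV[R]_m := \row_l (z 0 l + e / 2 * t ^+ l.+1).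
exists v => [l|w win].
  rewrite mxE addrC addKr ger0_norm ?mulr_ge0 ?exprn_ge0 ?(ltW t0) //; last lra.
  have : t ^+ l.+1 <= 1 by rewrite exprn_ile1 // ltW.
  by move: (t ^+ _) => s s1; nra.
apply: contra nr => /eqP h; rewrite /root horner_prod (big_rem w) //=.
suff Pwt : (P w).[t] = 0 by rewrite Pwt mul0r.
have := congr1 (fun M : matrix R 1 1 => M 0 0) h; rewrite !mxE => <-.
rewrite big_split_ord /= big_ord1 row_mxEl mxE eqxx mul1r.
rewrite /P hornerD hornerC /a -addrA; congr (_ + _).
rewrite horner_sum -big_split; apply: eq_bigr => l _ /=.
rewrite row_mxEr mxE hornerZ hornerXn mulrDl; congr (_ + _).
by rewrite mulrAC.
Qed.

(** Homogeneous coordinates: affine relations between points become linear relations. *)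
Definition aug m (v : 'rV[R]_m) : 'rV[R]_(1 + m) := row_mx 1%:M v.

(** One statement covers both uses: for each [i], any [k i] of the rows [aug (v j) *m T i] are
    independent. The identity for [T i] expresses affine independence, an incidence matrix the
    avoidance of an affine subspace. The points are placed one at a time. *)
Lemma general_position m (I : finType) (k : I -> nat) (T : forall i, 'M[R]_(1 + m, k i))
    (z : nat -> 'rV[R]_m) (e : R) (b : nat) :
  0 < e ->
  (forall i (c : 'cV_(k i)), T i *m c = 0 -> c = 0) ->
  exists v : nat -> 'rV[R]_m, (forall j l, (j < b)%N -> `|v j 0 l - z j 0 l| < e) /\
    forall i (la : nat -> R), (\sum_(j < b) (la j != 0)%R <= k i)%N ->
      \sum_(j < b) la j *: (aug (v j) *m T i) = 0 -> forall j, (j < b)%N -> la j = 0.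
Proof.
move=> e0 Tinj; elim: b => [|b [v [vz vP]]]; first by exists z.
(* Fewer than [k i] rows [aug (v j) *m T i] have a common nonzero kernel vector [c]. The hyperplane
   of [T i *m c], nonzero by injectivity, contains all these points and must be avoided by the next
   one. *)
have ex (iJ : {i : I & {J : {set 'I_b} | (#|J| < k i)%N}}) :
    exists w : 'cV[R]_(1 + m), [/\ w != 0, exists c, w = T (tag iJ) *m c &
      forall j, j \in sval (tagged iJ) -> aug (v j) *m w = 0].
  case: iJ => i [J Jk] /=.
  pose A : 'M[R]_(#|J|, k i) := \matrix_(r < #|J|) (aug (v (@enum_val _ (mem J) r : 'I_b)) *m T i).
  have [c c0 Ac] := exists_kernel_col A Jk; exists (T i *m c); split=> [||j jJ].
  - by apply: contra_neq c0; apply: Tinj.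
  - by exists c.
  rewrite mulmxA.
  have := congr1 (row (enum_rank_in jJ j)) Ac.
  by rewrite row_mul rowK enum_rankK_in // row0.
have [w hw] := choice ex.
have [] := @avoid_hyperplanes m
  [seq w iJ | iJ : {i : I & {J : {set 'I_b} | (#|J| < k i)%N}}] (z b) e e0.
  by move=> _ /mapP[iJ _ ->]; have [] := hw iJ.
move=> u uz uP; exists (fun j => if j == b then u else v j); split=> [j l|].
  by rewrite ltnS leq_eqVlt; case: eqP => [-> _|_ /= /vz //]; apply: uz.
move=> i la; rewrite !big_ord_recr /= eqxx.
rewrite (eq_bigr (fun j : 'I_b => la j *: (aug (v j) *m T i))); last first.
  by move=> j _; rewrite (ltn_eqF (ltn_ord j)).
have [lab|lab] := eqVneq (la b) 0.
  rewrite lab scale0r addr0 addn0 => h /(vP i la h) hla j.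
  by rewrite ltnS leq_eqVlt => /orP[/eqP ->|/hla].
(* If the new coefficient is nonzero, fewer than [k i] of the earlier ones are. Multiplying the
   relation by the vector [c] of that [J] leaves only the new term, so [u] would lie on a hyperplane
   it avoids. *)
rewrite addn1 => h sum0; exfalso; pose J : {set 'I_b} := finset (fun j : 'I_b => la j != 0).
have Jk : (#|J| < k i)%N.
  apply: leq_trans h; rewrite ltnS -sum1_card big_mkcond leq_sum // => j _.
  by rewrite inE; case: (_ != _).
pose iJ : {i : I & {J : {set 'I_b} | (#|J| < k i)%N}} :=
  Tagged (fun i => {J : {set 'I_b} | (#|J| < k i)%N}) (exist _ J Jk).
have [_ [c wE] wJ] := hw iJ.
have /eqP := congr1 (fun M => M *m c) sum0.
rewrite mul0mx mulmxDl mulmx_suml big1 ?add0r => [|j _].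
  rewrite -scalemxAl scaler_eq0 (negPf lab) /= -mulmxA -wE; apply/negP.
  by apply: (uP (w iJ)); apply: map_f; rewrite mem_enum.
have [->|laj] := eqVneq (la j) 0; first by rewrite scale0r mul0mx.
by rewrite -scalemxAl -mulmxA -wE wJ ?scaler0 //= inE.
Qed.

End GeneralPosition.

(** * Generic maps of small-dimensional compacta *)

Section GenericMap.
Context {R : realType}.
Implicit Types (x y z : {ptws nat -> R}) (P : set {ptws nat -> R}).
Local Notation cube := (@hilbert_cube R).
Local Notation d := (@cube_dist R).

(** Bumps [max 0 (r - d x y)] about net points are grouped by a member of the cover containing the
    ball, then normalised. The Lipschitz bound is what later allows sampling on a fine enough
    net. *)
Lemma partition_of_unity P b (V : 'I_b -> set {ptws nat -> R}) :
  P `<=` cube -> cube_closed P -> (forall j, open (V j)) -> P `<=` \bigcup_j V j ->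
  exists (la : nat -> {ptws nat -> R} -> R) (L : R),
    [/\ forall j x, P x -> 0 <= la j x,
      forall x, P x -> \sum_(j < b) la j x = 1,
      forall (j : 'I_b) x, P x -> la j x != 0 -> V j x &
      forall j x z, P x -> P z -> `|la j x - la j z| <= L * d x z].
Proof.
move=> Pc clP oV cov.
have ex y : exists jr : nat * R, 0 < jr.2 /\ (P y -> (jr.1 < b)%N /\
    forall j : 'I_b, val j = jr.1 -> forall z, P z -> d z y < jr.2 -> V j z).
  have [Py|] := pselect (P y); last by exists (0%N, 1).
  have [j _ Vjy] := cov y Py.
  have [r r0 hr] := open_cube_dist (oV j) (Pc y Py) Vjy.
  exists (val j, r); split=> // _; split=> [|i /val_inj -> z Pz]; first exact: ltn_ord.
  exact/hr/Pc.
have {ex}[jr hjr] := choice ex.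
(* With halved radii some bump is at least half its height at every point of [P], so the sum [S]
   stays above a positive [c]. *)
have [ys [ysP net]] := @finite_net R P (fun y => (jr y).2 / 2) Pc clP
  (fun y _ => divr_gt0 (hjr y).1 (ltr0n _ 2)).
pose w y x := Num.max 0 ((jr y).2 - d x y).
have w0 y x : 0 <= w y x by rewrite le_max lexx.
pose f j x := \sum_(y <- ys | (jr y).1 == j) w y x.
pose S x := \sum_(y <- ys) w y x.
have f0 j x : 0 <= f j x by apply: sumr_ge0.
have SE x : S x = \sum_(j < b) f j x.
  rewrite /S /f (exchange_big_dep xpredT) //= big_seq [RHS]big_seq.
  apply: eq_bigr => y yin; have [jlt _] := (hjr y).2 (ysP y yin).
  by rewrite (big_pred1 (Ordinal jlt)) // => i; rewrite /= eq_sym.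
have fS j x : f j x <= S x.
  by rewrite /f /S [leRHS](bigID (fun y => (jr y).1 == j)) /= lerDl sumr_ge0.
have [c c0 cS] : exists2 c, 0 < c & forall x, P x -> c <= S x.
  have [c c0 hc] : exists2 c, 0 < c & forall y, y \in ys -> c <= (jr y).2 / 2.
    elim: (ys) => [|y s [c c0 hc]]; first by exists 1.
    exists (Num.min c ((jr y).2 / 2)); first by rewrite lt_min c0 divr_gt0 // (hjr y).1.
    by move=> z; rewrite inE ge_min => /orP[/eqP ->|/hc ->] //; rewrite lexx orbT.
  exists c => // x Px; have [y yin dxy] := net x Px.
  rewrite /S (big_rem y) //=.
  apply: (@le_trans _ _ (w y x)); last by rewrite lerDl sumr_ge0.
  by rewrite le_max; apply/orP; right; have := hc y yin; lra.
have lipw (p : pred {ptws nat -> R}) x z : P x -> P z ->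
    `|\sum_(y <- ys | p y) w y x - \sum_(y <- ys | p y) w y z| <= (size ys)%:R * d x z.
  move=> Px Pz; have := ysP; have dxz := cube_dist_ge0 (Pc x Px) (Pc z Pz).
  elim: (ys) => [|y s IH] hs; first by rewrite !big_nil subrr normr0 mul0r.
  have Py : P y by apply: hs; rewrite inE eqxx.
  have {IH}IH := IH (fun y' h => hs y' (mem_behead (s := y :: s) h)).
  rewrite !big_cons /= -natr1 mulrDl mul1r; case: ifP => _; last by lra.
  rewrite opprD addrACA addrC; apply: (le_trans (ler_normD _ _)); apply: lerD => //.
  have d1 := cube_distD (Pc x Px) (Pc z Pz) (Pc y Py).
  have d2 := cube_distD (Pc z Pz) (Pc x Px) (Pc y Py); rewrite (cube_distC z x) in d2.
  rewrite /w ler_norml.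
  by case: (leP 0 ((jr y).2 - d x y)); case: (leP 0 ((jr y).2 - d z y)); lra.
exists (fun j x => f j x / S x), (2 * (size ys)%:R / c).
have S0 x : P x -> 0 < S x by move=> /cS; apply: lt_le_trans.
split=> [j x Px|x Px|j x Px|j x z Px Pz].
- by rewrite divr_ge0 // ltW // S0.
- by rewrite -mulr_suml -SE divff // gt_eqF // S0.
- move=> fj; have : f j x != 0 by apply: contra_neq fj => ->; rewrite mul0r.
  rewrite /f psumr_neq0 // => /hasP[y yin /andP[/eqP jy]].
  rewrite lt_max ltxx /= subr_gt0 => dxy.
  by have [_ /(_ j (esym jy) x Px dxy)] := (hjr y).2 (ysP y yin).
- have := lipw (fun y => (jr y).1 == j) x z Px Pz; rewrite -/(f j x) -/(f j z).
  have := lipw xpredT x z Px Pz; rewrite -/(S x) -/(S z).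
  rewrite (_ : 2 * _ / c * d x z = 2 * ((size ys)%:R * d x z) / c); last by ring.
  move: (_ * d x z) => D hS hf.
  have Sx := S0 x Px; have Sz := S0 z Pz; have cz := cS z Pz.
  have -> : f j x / S x - f j z / S z =
      (f j x / S x * (S z - S x) + (f j x - f j z)) / S z.
    by field; rewrite !gt_eqF.
  have r0 : 0 <= f j x / S x by rewrite divr_ge0 // ltW.
  have r1 : f j x / S x <= 1 by rewrite ler_pdivrMr // mul1r.
  have D0 : 0 <= D by apply: le_trans hS.
  rewrite normrM normfV (gtr0_norm Sz) ler_pdivrMr //.
  apply: (@le_trans _ _ (2 * D)).
    apply: (le_trans (ler_normD _ _)); rewrite normrM (ger0_norm r0).
    by rewrite distrC in hS; move: `|_| hS (normr_ge0 (S z - S x)) => u hu u0; nra.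
  rewrite -[leRHS]mulrA; apply: ler_peMr; first by rewrite mulr_ge0.
  by rewrite mulrC ler_pdivlMr // mul1r.
Qed.


(** The homogeneous form of the conditions that the [n + 1] coordinates [sg] take the values [Q] at
    [q]: the product with [aug v] lists the defects. *)
Definition incidence_mx m n s (sg : 'I_n.+1 -> 'I_m) (q : 'I_n.+1 -> 'I_s)
    (Q : 'I_s -> R) : 'M[R]_(1 + m, n.+1) :=
  col_mx (\row_c - Q (q c)) (\matrix_(l < m, c < n.+1) (l == sg c)%:R).

Lemma aug_incidence m n s sg q Q (v : 'rV[R]_m) :
  aug v *m @incidence_mx m n s sg q Q = \row_c (v 0 (sg c) - Q (q c)).
Proof.
rewrite /aug /incidence_mx mul_row_col mul1mx; apply/rowP => c.
rewrite !mxE (bigD1 (sg c)) //= big1 => [|l lc]; last first.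
  by rewrite mxE (negPf lc) mulr0.
by rewrite mxE eqxx mulr1 addr0 addrC.
Qed.

Lemma incidence_inj m n s sg q Q (c : 'cV[R]_n.+1) :
  injective sg -> @incidence_mx m n s sg q Q *m c = 0 -> c = 0.
Proof.
move=> sgI; rewrite /incidence_mx mul_col_mx -[0](@col_mx0 _ 1 m 1).
move=> /eq_col_mx[_ h]; apply/colP => k.
have := congr1 (fun M : matrix R m 1 => M (sg k) 0) h; rewrite !mxE => <-.
rewrite (bigD1 k) //= big1 => [|i ik]; first by rewrite mxE eqxx mul1r addr0.
by rewrite mxE (inj_eq sgI) eq_sym (negPf ik) mul0r.
Qed.

Lemma row_sum (m b : nat) (la : nat -> R) (v : nat -> 'rV[R]_m) :
  \sum_(j < b) la j *: aug (v j) =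
  row_mx (\sum_(j < b) la j)%:M (\sum_(j < b) la j *: v j).
Proof.
elim: b => [|b IH]; first by rewrite !big_ord0 raddf0 row_mx0.
rewrite !big_ord_recr /= IH /aug scale_row_mx add_row_mx; congr row_mx.
by rewrite raddfD /= scalemx1.
Qed.

(** [ta] is an arbitrary function, in use the piecewise constant one given by a table. Closeness is
    therefore stated against a constant [c] that [ta] approximates on a whole
    [eta]-neighbourhood. *)
Lemma separating_map P n s (ta : {ptws nat -> R} -> 'rV[R]_(2 * n + 1))
    (Q : 'I_s -> R) (eta e : R) :
  P `<=` cube -> cube_closed P -> covering_dim_lt P n.+1 -> 0 < eta -> 0 < e ->
  exists (ka : {ptws nat -> R} -> 'rV[R]_(2 * n + 1)) (L : R),
    [/\ forall x z l, P x -> P z -> `|ka x 0 l - ka z 0 l| <= L * d x z,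
      forall x (c : 'rV[R]_(2 * n + 1)) rho, P x ->
        (forall z l, P z -> d x z < eta -> `|ta z 0 l - c 0 l| <= rho) ->
        forall l, `|ka x 0 l - c 0 l| <= rho + e,
      forall x z, P x -> P z -> eta <= d x z -> ka x <> ka z &
      forall x, P x -> (#|[pred l | [exists i : 'I_s, ka x 0%R l == Q i]]| <= n)%N].
Proof.
set m := (2 * n + 1)%N => Pc clP dimP eta0 e0.
have [b [V [oV covV smallV ordV]]] := fine_cover Pc clP dimP eta0.
have [la [L [la0 la1 laV laL]]] := partition_of_unity Pc clP oV covV.
(* A sample point in each member meeting [P]; the other members have weight zero on [P]. *)
have ex j : exists y, forall k : 'I_b, val k = j -> forall x, P x -> V k x -> P y /\ V k y.
  have [[k [kj [y [Py Vy]]]]|no] :=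
      pselect (exists k : 'I_b, val k = j /\ exists y, P y /\ V k y).
    by exists y => i ij x _ _; rewrite -kj in ij; rewrite (val_inj ij).
  by exists (fun=> 0) => k kj x Px Vx; case: no; exists k; split=> //; exists x.
have {ex}[y hy] := choice ex.
(* [None] stands for affine independence of up to [1 + m = 2n + 2] vertices, [Some] for each choice
   of [n + 1] distinct coordinates with prescribed values. *)
pose I : finType := option ({sg : {ffun 'I_n.+1 -> 'I_m} | injectiveb sg} *
   {ffun 'I_n.+1 -> 'I_s}).
pose k (i : I) := if i is Some _ then n.+1 else (1 + m)%N.
pose T (i : I) : 'M[R]_(1 + m, k i) := match i with
  | Some p => incidence_mx (sval p.1) p.2 Q
  | None => 1%:M end.
have [] := @general_position R m I k T (fun j => ta (y j)) e b e0.
  case=> [[[sg sgI] q]|] c /=; last by rewrite mul1mx.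
  exact/incidence_inj/injectiveP.
move=> v [vta vP].
pose ka x := \sum_(j < b) la j x *: v j.
have kaE x l : ka x 0 l = \sum_(j < b) la j x * v j 0 l.
  by rewrite /ka summxE; apply: eq_bigr => j _; rewrite mxE.
have supp x : P x -> (\sum_(j < b) (la j x != 0)%R <= n.+1)%N.
  move=> Px; apply: leq_trans (ordV x Px); rewrite -sum1_card [leqRHS]big_mkcond leq_sum //.
  move=> j _; case: eqVneq => //= h; rewrite inE.
  by case: asboolP => // nV; case: nV; apply: laV.
have augka x : P x -> \sum_(j < b) la j x *: aug (v j) = aug (ka x).
  by move=> Px; rewrite (row_sum b (la^~ x)) la1.
exists ka, (\sum_(j < b) \sum_(l < m) L * `|v j 0 l|); split.
- move=> x z l Px Pz; rewrite !kaE -sumrB.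
  rewrite (le_trans (ler_norm_sum _ _ _)) // mulr_suml ler_sum // => j _.
  rewrite -mulrBl normrM.
  apply: le_trans (ler_wpM2r (normr_ge0 _) (laL j x z Px Pz)) _.
  rewrite mulrAC; have Ld : 0 <= L * d x z by apply: le_trans (laL 0%N x z Px Pz).
  rewrite mulr_suml (bigD1 l) //= lerDl sumr_ge0 // => i _.
  by rewrite mulrAC mulr_ge0.
- move=> x c rho Px h l; rewrite kaE -[c 0 l]mul1r -(la1 x Px) mulr_suml -sumrB.
  rewrite (le_trans (ler_norm_sum _ _ _)) // -[leRHS]mul1r -(la1 x Px) mulr_suml.
  apply: ler_sum => j _; rewrite -mulrBr normrM (ger0_norm (la0 j x Px)).
  have [->|laj] := eqVneq (la j x) 0; first by rewrite !mul0r.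
  have Vx := laV j x Px laj; have [Py Vy] := hy j j erefl x Px Vx.
  rewrite ler_wpM2l ?la0 // -(subrKA (ta (y j) 0 l)) (le_trans (ler_normD _ _)) //.
  rewrite [leLHS]addrC; apply: lerD; last by apply: ltW; apply: vta.
  by apply: h => //; apply: (smallV j).
- move=> x z Px Pz dxz kaxz.
  pose mu j := la j x - la j z.
  (* Each point has at most [n + 1] nonzero weights, so [mu] has at most [2n + 2]. Equal weights put
     both points into a common member of the cover, of diameter below [eta]. *)
  have mu0 : forall j, (j < b)%N -> mu j = 0.
    apply: (vP None mu) => /=.
      apply: (@leq_trans (n.+1 + n.+1)); last by rewrite /m; lia.
      apply: leq_trans (leq_add (supp x Px) (supp z Pz)).
      rewrite -big_split leq_sum // => j _ /=; rewrite /mu.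
      have [x0|x0] := eqVneq (la j x) 0; last exact: leq_trans (leq_b1 _) _.
      have [z0|z0] := eqVneq (la j z) 0; last exact: leq_trans (leq_b1 _) _.
      by rewrite x0 z0 subrr eqxx.
    under eq_bigr => j _ do rewrite mulmx1 scalerBl.
    by rewrite sumrB !augka // kaxz subrr.
  have [j laj] : exists j : 'I_b, la j x != 0.
    apply: contrapT => no; have := la1 x Px; rewrite big1 => [/eqP|j _].
      by rewrite eq_sym oner_eq0.
    by apply/eqP/negPn/negP => h; apply: no; exists j.
  have := mu0 j (ltn_ord j) => /eqP; rewrite subr_eq0 => /eqP lajE.
  have Vx := laV j x Px laj; rewrite lajE in laj; have Vz := laV j z Pz laj.
  by have := smallV j x z Px Pz Vx Vz; rewrite ltNge dxz.
- move=> x Px; rewrite leqNgt; apply/negP => big.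
  pose A := [pred l | [exists i : 'I_s, ka x 0 l == Q i]].
  pose sg := [ffun c : 'I_n.+1 => @enum_val _ A (widen_ord big c)].
  have sgI : injectiveb sg.
    by apply/injectiveP => i j; rewrite !ffunE => /enum_val_inj /(congr1 val) /= /val_inj.
  have sgA c : exists i : 'I_s, ka x 0 (sg c) = Q i.
    have : sg c \in A by rewrite ffunE; apply: enum_valP.
    by move=> /existsP[i /eqP h]; exists i.
  have [q hq] := choice sgA.
  pose i : I := Some (exist _ sg sgI, finfun q).
  (* The coordinate conditions are a relation among at most [n + 1] vertices, so all weights would
     vanish although their sum is 1. *)
  have la_eq0 : forall j, (j < b)%N -> la j x = 0.
    apply: (vP i (fun j => la j x)); first exact: supp.
    under eq_bigr => j _ do rewrite scalemxAl.
    rewrite -mulmx_suml augka //= aug_incidence; apply/rowP => c.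
    by rewrite !mxE hq ffunE subrr.
  have := la1 x Px; rewrite big1 => [/eqP|j _]; first by rewrite eq_sym oner_eq0.
  exact: la_eq0.
Qed.

End GenericMap.

(** * Finite tables *)

Section Tables.
Context (c r : nat -> nat) (m n : nat).

(** A table is one number coding six fields: radius exponent, tolerance [1 / (e + 1)], grid level of
    the covering certificate, number of entries, their points, their values. *)
Definition tab_N w := cnth w 0.
Definition tab_e w := cnth w 1.
Definition tab_t w := cnth w 2.
Definition tab_size w := cnth w 3.
Definition tab_pt w j := cnth (cnth w 4) j.
Definition tab_val w j := cnth (cnth w 5) j.
Definition tab_rad w : rat := 2^-1 ^+ tab_N w.
Definition tab_tol w : rat := (tab_e w).+1%:R^-1.

Definition vec_close v v' (e : rat) : bool :=
  all (fun l => `|ratseq_of_code v l - ratseq_of_code v' l| <= e) (iota 0 m).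

(** Every grid point at level [tab_t w] lies well inside the half-size balls
    about the points of the table or well inside one of the removed balls. *)
Definition tab_covers w : bool :=
  all (fun a =>
    has (fun j => qdist a (tab_pt w j) < 2^-1 ^+ (tab_N w).+1 - 2^-1 ^+ tab_t w)
      (iota 0 (tab_size w)) ||
    has (fun k => qdist a (c k) < rat_of_code (r k) - 2^-1 ^+ tab_t w)
      (iota 0 (tab_t w)))
    (iota 0 (dense_bound (tab_t w))).

(** The continuity surrogate that makes extension possible: a quarter of the tolerance leaves room
    for the perturbation to general position. *)
Definition tab_tame w : bool :=
  all (fun i => all (fun j =>
    (qdist (tab_pt w i) (tab_pt w j) < tab_rad w + tab_rad w) ==>
    vec_close (tab_val w i) (tab_val w j) (tab_tol w * 2^-1 ^+ 2))
    (iota 0 (tab_size w))) (iota 0 (tab_size w)).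

(** The difference of tolerances says that the box about the new value lies in the box about the old
    one; such bounds telescope. *)
Definition tab_coherent u w : bool :=
  all (fun i => all (fun j =>
    (qdist (tab_pt u i) (tab_pt w j) < tab_rad u + tab_rad w) ==>
    vec_close (tab_val u i) (tab_val w j) (tab_tol u - tab_tol w))
    (iota 0 (tab_size w))) (iota 0 (tab_size u)).

(** The factor 4 is 3 + 1: values within [3 tol] and within [tol] of one limit value cannot belong
    to distant entries. *)
Definition tab_separates s w : bool :=
  all (fun i => all (fun j =>
    (2^-1 ^+ s <= qdist (tab_pt w i) (tab_pt w j)) ==>
    has (fun l => 4%:R * tab_tol w <=
      `|ratseq_of_code (tab_val w i) l - ratseq_of_code (tab_val w j) l|) (iota 0 m))
    (iota 0 (tab_size w))) (iota 0 (tab_size w)).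

Definition tab_avoids s w : bool :=
  all (fun j => count (fun l =>
     has (fun i => (`|ratseq_of_code (tab_val w j) l - rat_of_code i| <= tab_tol w)%R)
       (iota 0 s.+1)) (iota 0 m) <= n)%N
    (iota 0 (tab_size w)).

Definition tab_small s w : bool := (s <= tab_N w)%N && (tab_tol w <= 2^-1 ^+ s).

Definition tab_valid w : bool := tab_covers w && tab_tame w.

Definition tab_step s u w : bool :=
  [&& tab_valid w, tab_coherent u w, tab_separates s w, tab_avoids s w & tab_small s w].

End Tables.

Lemma rcmp_qcoord E (o : E -> nat -> nat) vs A B : cmp o vs A -> cmp o vs B ->
  rcmp o vs (fun x => qcoord (A x) (B x)).
Proof. by move=> cA cB; apply: rcmp_clip; apply: rcmp_ratseq. Qed.

Lemma rcmp_qdist E (o : E -> nat -> nat) vs A B : cmp o vs A -> cmp o vs B ->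
  rcmp o vs (fun x => qdist (A x) (B x)).
Proof.
move=> cA cB; apply: (@rcmp_sum _ _ _ (fun x => A x + B x)%N
  (fun l x => `|qcoord (A x) l - qcoord (B x) l| * 2^-1 ^+ l.+1)); first exact: cmp_add.
apply: rcmp_mul; last by apply: rcmp_half; apply: cmp_S; cmp_leaf.
by apply: rcmp_norm; apply: rcmp_sub; apply: rcmp_qcoord; cmp_leaf.
Qed.

Lemma cmp_code_bound E (o : E -> nat -> nat) vs A B : cmp o vs A -> cmp o vs B ->
  cmp o vs (fun x => code_bound (A x) (B x)).
Proof.
move=> cA cB; apply: (cmp_rec (S := fun _ b x => 2 ^ A x * b.*2.+1)%N) => //.
  exact: cmp_const.
apply: cmp_mul; first by apply: cmp_exp; cmp_leaf.
apply: cmp_S; apply: eq_cmp (_ : cmp _ _ (fun y => y.2.1 + y.2.1)%N).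
  by move=> y; exact: addnn.
by apply: cmp_add; cmp_leaf.
Qed.

Lemma cmp_dense_bound E (o : E -> nat -> nat) vs A : cmp o vs A ->
  cmp o vs (fun x => dense_bound (A x)).
Proof.
move=> cA; apply: cmp_S; apply: cmp_code_bound; last exact: cmp_S.
apply: cmp_code_bound; last exact: cmp_const.
by apply: cmp_exp; [exact: cmp_const|exact: cmp_S].
Qed.

Section TableClosure.
Context (E : Type) (o : E -> nat -> nat) (vs : seq (E -> nat)).
Implicit Types (A B W : E -> nat).

Lemma cmp_tab_N W : cmp o vs W -> cmp o vs (fun x => tab_N (W x)).
Proof. by move=> cW; apply: cmp_cnth; cmp_leaf. Qed.
Lemma cmp_tab_e W : cmp o vs W -> cmp o vs (fun x => tab_e (W x)).
Proof. by move=> cW; apply: cmp_cnth; cmp_leaf. Qed.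
Lemma cmp_tab_t W : cmp o vs W -> cmp o vs (fun x => tab_t (W x)).
Proof. by move=> cW; apply: cmp_cnth; cmp_leaf. Qed.
Lemma cmp_tab_size W : cmp o vs W -> cmp o vs (fun x => tab_size (W x)).
Proof. by move=> cW; apply: cmp_cnth; cmp_leaf. Qed.
Lemma cmp_tab_pt W A : cmp o vs W -> cmp o vs A -> cmp o vs (fun x => tab_pt (W x) (A x)).
Proof. by move=> cW cA; apply: cmp_cnth => //; apply: cmp_cnth; cmp_leaf. Qed.
Lemma cmp_tab_val W A : cmp o vs W -> cmp o vs A -> cmp o vs (fun x => tab_val (W x) (A x)).
Proof. by move=> cW cA; apply: cmp_cnth => //; apply: cmp_cnth; cmp_leaf. Qed.
Lemma rcmp_tab_rad W : cmp o vs W -> rcmp o vs (fun x => tab_rad (W x)).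
Proof. by move=> cW; apply: rcmp_half; apply: cmp_tab_N. Qed.
Lemma rcmp_tab_tol W : cmp o vs W -> rcmp o vs (fun x => tab_tol (W x)).
Proof. by move=> cW; apply: rcmp_inv; apply: cmp_tab_e. Qed.
End TableClosure.

Ltac cmp_auto := repeat first
  [ cmp_leaf
  | match goal with
    | |- cmp _ _ (fun x => S _) => apply: cmp_S
    | |- cmp _ _ (fun x => tab_N _) => apply: cmp_tab_N
    | |- cmp _ _ (fun x => tab_e _) => apply: cmp_tab_e
    | |- cmp _ _ (fun x => tab_t _) => apply: cmp_tab_t
    | |- cmp _ _ (fun x => tab_size _) => apply: cmp_tab_size
    | |- cmp _ _ (fun x => tab_pt _ _) => apply: cmp_tab_pt
    | |- cmp _ _ (fun x => tab_val _ _) => apply: cmp_tab_val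
    | |- cmp _ _ (fun x => dense_bound _) => apply: cmp_dense_bound
    | |- rcmp _ _ (fun x => tab_rad _) => apply: rcmp_tab_rad
    | |- rcmp _ _ (fun x => tab_tol _) => apply: rcmp_tab_tol
    | |- rcmp _ _ (fun x => qdist _ _) => apply: rcmp_qdist
    | |- rcmp _ _ (fun x => ratseq_of_code _ _) => apply: rcmp_ratseq
    | |- rcmp _ _ (fun x => rat_of_code _) => apply: rcmp_code
    | |- rcmp _ _ (fun x => _ ^+ _) => apply: rcmp_half
    | |- rcmp _ _ (fun x => `| _ |) => apply: rcmp_norm
    | |- rcmp _ _ (fun x => _ - _) => apply: rcmp_sub
    | |- rcmp _ _ (fun x => _ + _) => apply: rcmp_add
    | |- rcmp _ _ (fun x => _ * _) => apply: rcmp_mul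
    | |- rcmp _ _ (fun x => _%:R) => apply: rcmp_nat
    | |- bcmp _ _ (fun x => _ && _) => apply: bcmp_and
    | |- bcmp _ _ (fun x => _ || _) => apply: bcmp_or
    | |- bcmp _ _ (fun x => _ ==> _) => apply: bcmp_imp
    | |- bcmp _ _ (fun x => (_ <= _)%R) => apply: bcmp_le
    | |- bcmp _ _ (fun x => (_ < _)%R) => apply: bcmp_lt
    | |- bcmp _ _ (fun x => leq _ _) => apply: bcmp_leq
    | |- bcmp _ _ (fun x => all (fun i => @?P x i) (iota 0 (@?N x))) =>
        refine (@bcmp_all _ _ _ N (fun i x => P x i) _ _)
    | |- bcmp _ _ (fun x => has (fun i => @?P x i) (iota 0 (@?N x))) =>
        refine (@bcmp_has _ _ _ N (fun i x => P x i) _ _)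
    | |- cmp _ _ (fun x => count (fun i => @?P x i) (iota 0 (@?N x))) =>
        refine (@cmp_count _ _ _ N (fun i x => P x i) _ _)
    | |- cmp _ _ (fun x => find (fun i => @?P x i) (iota 0 (@?N x))) =>
        refine (@cmp_find _ _ _ N (fun i x => P x i) _ _)
    end; cbv beta ].

Lemma bcmp_tab_step c r m n : computable_seq c -> computable_seq r ->
  forall E (o : E -> nat -> nat) vs S U W, cmp o vs S -> cmp o vs U -> cmp o vs W ->
  bcmp o vs (fun x => tab_step c r m n (S x) (U x) (W x)).
Proof.
move=> cc cr E o vs S U W cS cU cW.
rewrite /tab_step /tab_valid /tab_covers /tab_tame /tab_coherent /tab_separates
  /tab_avoids /tab_small /vec_close.
cmp_auto.


cmp_auto.
all: by apply: cmp_seq => //; cmp_auto.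
Qed.

(** * Construction of tables *)

Lemma all_iotaP (p : nat -> bool) n :
  all p (iota 0 n) <-> forall i, (i < n)%N -> p i.
Proof.
split=> [/allP h i ilt|h]; first by apply: h; rewrite mem_iota.
by apply/allP => i; rewrite mem_iota => /h.
Qed.

Lemma has_iotaP (p : nat -> bool) n :
  has p (iota 0 n) <-> exists2 i, (i < n)%N & p i.
Proof.
split=> [/hasP[i iin pi]|[i ilt pi]]; first by exists i => //; rewrite mem_iota in iin.
by apply/hasP; exists i; rewrite ?mem_iota.
Qed.

Lemma count_iota_card (p : nat -> bool) m :
  count p (iota 0 m) = #|[pred l : 'I_m | p l]|.
Proof.
rewrite -sum1_count -sum1_card -[X in iota 0 X]subn0 -/(index_iota 0 m) big_mkord.
exact: eq_bigl.
Qed.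

Lemma rat_code_surj q : exists k, rat_of_code k = q.
Proof.
have d0 : (denq q)%:~R != 0 :> rat by rewrite intr_eq0 denq_neq0.
have dE : (denq q)%:~R = `|denq q|%N.-1.+1%:R :> rat.
  by rewrite prednK ?absz_gt0 ?denq_neq0 // -[in LHS](gtz0_abs (denq_gt0 q)).
exists (CodeSeq.code (if numq q is Posz a then [:: a; 0%N; `|denq q|%N.-1]
   else [:: 0%N; `|numq q|%N; `|denq q|%N.-1])).
rewrite /rat_of_code CodeSeq.codeK -[RHS]divq_num_den dE.
case: (numq q) => a /=; first by rewrite subr0.
have -> : (Negz a)%:~R = - a.+1%:R :> rat by rewrite NegzE mulrNz.
by rewrite sub0r.
Qed.

Section BuildTables.
Context {R : realType} (P : set {ptws nat -> R}) (c r : nat -> nat).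
Hypothesis PE : P = @hilbert_cube R `\`
  \bigcup_k [set x | cube_dist x (cube_dense (c k)) < ratr (rat_of_code (r k))].

Local Notation half n := (2^-1 ^+ n : R).
Local Notation cube := (@hilbert_cube R).
Local Notation d := (@cube_dist R).
Local Notation pt w j := (@cube_dense R (tab_pt w j)).
Local Notation tol w := ((tab_e w).+1%:R^-1 : R).
Definition tab_coord w j l : R := ratr (ratseq_of_code (tab_val w j) l).

Lemma ratr_half k : ratr (2^-1 ^+ k) = half k.
Proof. by rewrite rmorphXn /= fmorphV /= ratr_nat. Qed.

Lemma ratr_tol w : ratr (tab_tol w) = tol w.
Proof. by rewrite /tab_tol fmorphV /= ratr_nat. Qed.

Lemma tol_gt0 w : 0 < tol w.
Proof. by rewrite invr_gt0 ltr0n. Qed.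

Lemma vec_closeP m u i w j e : vec_close m (tab_val u i) (tab_val w j) e <->
  forall l, (l < m)%N -> `|tab_coord u i l - tab_coord w j l| <= ratr e.
Proof.
rewrite all_iotaP; split=> h l lm; have := h l lm.
  by rewrite /tab_coord -rmorphB -ratr_norm ler_rat.
by rewrite /tab_coord -rmorphB -ratr_norm ler_rat.
Qed.

Lemma Pi01_sub : P `<=` cube.
Proof. by rewrite PE => x []. Qed.

Lemma Pi01_out x k : P x -> ~ d x (cube_dense (c k)) < ratr (rat_of_code (r k)).
Proof. by rewrite PE => -[_ h] dx; apply: h; exists k. Qed.

Lemma Pi01_not x : cube x -> ~ P x ->
  exists k, d x (cube_dense (c k)) < ratr (rat_of_code (r k)).
Proof.
move=> cx; apply: contra_notP => no; rewrite PE; split=> // -[k _ /= h].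
by apply: no; exists k.
Qed.

Lemma Pi01_closed : cube_closed P.
Proof.
move=> x cx /(Pi01_not cx)[k dk].
exists (ratr (rat_of_code (r k)) - d x (cube_dense (c k))); first by rewrite subr_gt0.
move=> z cz dzx /(Pi01_out (k := k)); apply.
have := cube_distD cz cx (cube_dense_cube (c k)); lra.
Qed.

Lemma near_trans (u v w e f : R) : u <= v + w -> v <= e -> w < f - e -> u < f.
Proof. lra. Qed.

Lemma near_trans4 (x u v s t h k : R) :
  x <= u + v -> u < h -> v <= s + t -> s < k + k -> t < h -> x < h + k + k + h.
Proof. lra. Qed.

(** The margin in the certificate pays for passing from a grid point to [x]; a point of [P] lies in
    no removed ball, so a table ball remains. *)
Lemma tab_coversP w x : tab_covers c r w -> P x ->
  exists2 j, (j < tab_size w)%N & d x (pt w j) < half (tab_N w).+1.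
Proof.
move=> /all_iotaP cov Px; have cx := Pi01_sub Px.
have [a alt dxa] := cube_dense_near (tab_t w) cx.
have ca := cube_dense_cube (R := R) a.
case/orP: (cov a alt) => /has_iotaP[j jlt].
  rewrite -(ltr_rat R) -cube_dist_dense rmorphB /= !ratr_half => daj.
  exists j => //.
  exact: near_trans (cube_distD cx ca (cube_dense_cube (tab_pt w j))) dxa daj.
rewrite -(ltr_rat R) -cube_dist_dense rmorphB /= ratr_half => dac.
exfalso; apply: (Pi01_out (k := j) Px).
exact: near_trans (cube_distD cx ca (cube_dense_cube (c j))) dxa dac.
Qed.

Lemma exists_nat_gt (x : R) : exists k : nat, x < k%:R.
Proof.
exists (Num.bound `|x|); apply: le_lt_trans (ler_norm x) _.
by apply: archi_boundP.
Qed.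

Lemma exists_vec_code m (v : nat -> R) (e : R) : 0 < e ->
  exists k, forall l, (l < m)%N -> `|ratr (ratseq_of_code k l) - v l| <= e.
Proof.
move=> e0; have ex l : exists k, `|ratr (rat_of_code k) - v l| <= e.
  have [q] : exists q : rat, ratr q \in `]v l - e, v l + e[.
    by apply: rat_in_itvoo; lra.
  rewrite in_itv /= => /andP[h1 h2]; have [k kq] := rat_code_surj q.
  by exists k; rewrite kq ler_norml; lra.
have [k hk] := choice ex; exists (CodeSeq.code (mkseq k m)) => l lm.
by rewrite /ratseq_of_code CodeSeq.codeK nth_mkseq.
Qed.

(** Completeness of the certificate: table balls and removed balls together cover the compact cube,
    so they do so with a uniform margin and finitely many removed balls. *)
Lemma cover_certificate (as_ : seq nat) (N : nat) :
  (forall x, P x -> exists2 a, a \in as_ & d x (cube_dense a) < half N) ->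
  exists t, forall a,
    (exists2 b, b \in as_ & qdist a b < 2^-1 ^+ N - 2^-1 ^+ t) \/
    (exists2 k, (k < t)%N & qdist a (c k) < rat_of_code (r k) - 2^-1 ^+ t).
Proof.
move=> cov.
(* The condition [k%:R * g <= 1] bounds the index by [1 / g], so one parameter, monotone as
   [cube_uniform] requires, controls both margin and index. *)
pose Good (g : R) x :=
  (exists2 b, b \in as_ & d x (cube_dense b) < half N - g) \/
  (exists2 k, k%:R * g <= 1 & d x (cube_dense (c k)) < ratr (rat_of_code (r k)) - g).
have [|g g' x gg' [[b bin h]|[k kg h]]||g g0 hg] :=
    @cube_uniform R cube Good _ (@cube_closed_cube R).
- by [].
- by left; exists b => //; lra.
- right; exists k; last lra; apply: le_trans kg.
  by rewrite ler_wpM2l.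
- move=> x cx; have [Px|nPx] := pselect (P x).
    have [b bin dxb] := cov x Px.
    exists ((half N - d x (cube_dense b)) / 2); first lra.
    move=> z cz dzx; left; exists b => //.
    have := cube_distD cz cx (cube_dense_cube b); lra.
  have [k dxk] := Pi01_not cx nPx.
  exists (Num.min ((ratr (rat_of_code (r k)) - d x (cube_dense (c k))) / 2) k.+1%:R^-1).
    by rewrite lt_min invr_gt0 ltr0n andbT; lra.
  move=> z cz; rewrite lt_min => /andP[dzx _]; right; exists k.
    rewrite (@le_trans _ _ (k%:R * k.+1%:R^-1)) //.
      by rewrite ler_wpM2l // ge_min lexx orbT.
    by rewrite ler_pdivrMr ?ltr0n // mul1r ler_nat.
  have := cube_distD cz cx (cube_dense_cube (c k)).
  have : Num.min ((ratr (rat_of_code (r k)) - d x (cube_dense (c k))) / 2) k.+1%:R^-1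
    <= (ratr (rat_of_code (r k)) - d x (cube_dense (c k))) / 2 by rewrite ge_min lexx.
  lra.
have [t0 ht0] := exists_half_lt g0; have [T hT] := exists_nat_gt g^-1.
exists (maxn t0 T) => a.
have tg : half (maxn t0 T) <= g.
  by apply: le_trans (ltW ht0); apply: half_le; apply: leq_maxl.
case: (hg _ (cube_dense_cube a)) => [[b bin h]|[k kg h]]; [left; exists b|right; exists k] => //.
- by rewrite -(ltr_rat R) -cube_dist_dense rmorphB /= !ratr_half; lra.
- apply: leq_trans (leq_maxr _ _); rewrite -(ltr_nat R); apply: le_lt_trans hT.
  by rewrite -div1r ler_pdivlMr.
- by rewrite -(ltr_rat R) -cube_dist_dense rmorphB /= !ratr_half; lra.
Qed.

(** Centres of overlapping balls have sample points less than [4 * half N] apart. One twelfth of the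
    tolerance for this move and one for each of the two roundings make the quarter that tameness
    allows. *)
Lemma build_table m (ka : {ptws nat -> R} -> nat -> R) (L : R) (e N0 : nat) :
  (forall x z l, (l < m)%N -> P x -> P z -> `|ka x l - ka z l| <= L * d x z) ->
  exists w, [/\ tab_e w = e, (N0 <= tab_N w)%N, tab_covers c r w, tab_tame m w &
    forall j, (j < tab_size w)%N -> exists2 x, P x &
      d x (pt w j) < half (tab_N w) /\
      forall l, (l < m)%N -> `|tab_coord w j l - ka x l| <= tol w / 12].
Proof.
move=> lip; set de : R := e.+1%:R^-1.
have de0 : 0 < de by rewrite invr_gt0 ltr0n.
(* 48 is 4 times 12; [L] may be zero or negative, hence the denominator. *)
have [M hM] := @exists_half_lt R (de / 48 / (`|L| + 1)) ltac:(by rewrite !divr_gt0 // ltr_wpDl).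
pose N := maxn N0 M.
have LN : L * (half N + half N + half N + half N) <= de / 12.
  have : half N <= de / 48 / (`|L| + 1).
    by apply: le_trans (ltW hM); apply: half_le; apply: leq_maxr.
  rewrite ler_pdivlMr ?ltr_wpDl // => h; have := ler_norm L.
  by have := half_gt0 (R := R) N; move: (half N) h => h h1 h0; nra.
have [ys [ysP net]] := @finite_net R P (fun=> half N.+2) Pi01_sub Pi01_closed
  (fun _ _ => half_gt0 _).
have exa y : exists a, P y -> d y (cube_dense a) <= half N.+3.
  have [Py|] := pselect (P y); last by exists 0%N.
  by have [a _ ha] := cube_dense_near N.+3 (Pi01_sub Py); exists a.
have {exa}[a ha] := choice exa.
have exv y := @exists_vec_code m (ka y) (de / 12) ltac:(by rewrite divr_gt0).
have {exv}[v hv] := choice exv.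
have [|t ht] := @cover_certificate [seq a y | y <- ys] N.+1.
  move=> x Px; have [y yin dxy] := net x Px; have Py := ysP y yin.
  exists (a y); first exact: map_f.
  have := cube_distD (Pi01_sub Px) (Pi01_sub Py) (cube_dense_cube (a y)).
  have := ha y Py; have := halfS (R := R) N.+1; have := halfS (R := R) N.+2.
  by have := half_gt0 (R := R) N.+3; lra.
pose w := CodeSeq.code [:: N; e; t; size ys;
  CodeSeq.code [seq a y | y <- ys]; CodeSeq.code [seq v y | y <- ys]].
have wN : tab_N w = N by rewrite /tab_N /cnth CodeSeq.codeK.
have we : tab_e w = e by rewrite /tab_e /cnth CodeSeq.codeK.
have wt : tab_t w = t by rewrite /tab_t /cnth CodeSeq.codeK.
have wK : tab_size w = size ys by rewrite /tab_size /cnth CodeSeq.codeK.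
have wpt j : (j < size ys)%N -> tab_pt w j = a (nth (fun=> 0) ys j).
  move=> jlt; rewrite /tab_pt /cnth /w !CodeSeq.codeK.
  by rewrite (nth_map (fun=> 0)).
have wval j : (j < size ys)%N -> tab_val w j = v (nth (fun=> 0) ys j).
  move=> jlt; rewrite /tab_val /cnth /w !CodeSeq.codeK.
  by rewrite (nth_map (fun=> 0)).
have wP j : (j < size ys)%N -> P (nth (fun=> 0) ys j) by move=> jlt; apply/ysP/mem_nth.
have wd j : (j < size ys)%N -> d (nth (fun=> 0) ys j) (pt w j) < half N.
  move=> jlt; rewrite wpt //; apply: le_lt_trans (ha _ (wP j jlt)) _.
  have := halfS (R := R) N; have := halfS (R := R) N.+1; have := halfS (R := R) N.+2.
  by have := half_gt0 (R := R) N.+3; lra.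
have wv j l : (j < size ys)%N -> (l < m)%N ->
    `|tab_coord w j l - ka (nth (fun=> 0) ys j) l| <= de / 12.
  by move=> jlt lm; rewrite /tab_coord wval //; apply: hv.
exists w; rewrite we wN; split=> //.
- exact: leq_maxl.
- rewrite /tab_covers wt wK wN; apply/all_iotaP => b _.
  apply/orP; case: (ht b) => [[b' /(nthP 0%N)[j jlt <-] dj]|[k kt dk]]; last first.
    by right; apply/has_iotaP; exists k.
  move: jlt dj; rewrite size_map => jlt; rewrite (nth_map (fun=> 0)) // => dj.
  by left; apply/has_iotaP; exists j; rewrite ?wpt.
- apply/all_iotaP => i; rewrite wK => ilt; apply/all_iotaP => j jlt; apply/implyP.
  rewrite -(ltr_rat R) -cube_dist_dense rmorphD /= ratr_half wN => dij.
  apply/vec_closeP => l lm; rewrite rmorphM /= ratr_tol ratr_half we.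
  have := wv i l ilt lm; have := wv j l jlt lm.
  have := lip _ _ l lm (wP i ilt) (wP j jlt).
  have : L * d (nth (fun=> 0) ys i) (nth (fun=> 0) ys j) <= de / 12.
    have d1 := wd i ilt; have d2 := wd j jlt.
    have t1 := cube_distD (Pi01_sub (wP i ilt)) (cube_dense_cube (tab_pt w i))
      (Pi01_sub (wP j jlt)).
    have t2 := cube_distD (cube_dense_cube (tab_pt w i)) (cube_dense_cube (tab_pt w j))
      (Pi01_sub (wP j jlt)).
    rewrite (cube_distC (pt w j)) in t2.
    have [L0|L0] := leP 0 L.
      by apply: le_trans LN; rewrite ler_wpM2l //; apply: ltW; apply: near_trans4 t1 d1 t2 dij d2.
    apply: (@le_trans _ _ 0); last by rewrite divr_ge0 // ltW.
    by rewrite nmulr_rle0 // cube_dist_ge0 //; apply: Pi01_sub; apply: wP.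
  rewrite -/de expr2 !ler_norml; lra.
- rewrite wK => j jlt; exists (nth (fun=> 0) ys j); first exact: wP.
  by split=> [|l lm]; [exact: wd|exact: wv].
Qed.

End BuildTables.

(** * Refinement of tables *)

Lemma finite_pos_bound (R : realFieldType) (F : finType) (f : F -> R) :
  exists2 g, 0 < g & forall i, 0 < f i -> g <= f i.
Proof.
suff [g g0 hg] : exists2 g, 0 < g & forall i, i \in enum F -> 0 < f i -> g <= f i.
  by exists g => // i; apply: hg; rewrite mem_enum.
elim: (enum F) => [|i s [g g0 hg]]; first by exists 1.
have [fi|fi] := leP (f i) 0.
  exists g => // j; rewrite inE => /orP[/eqP ->|]; last exact: hg.
  by rewrite ltNge fi.
exists (Num.min g (f i)); first by rewrite lt_min g0.
move=> j; rewrite inE ge_min => /orP[/eqP -> _|/hg h /h -> //].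
by rewrite lexx orbT.
Qed.

(** * Uniform gaps by compactness *)

Section Gaps.
Context {R : realType} (P : set {ptws nat -> R}).
Local Notation cube := (@hilbert_cube R).
Local Notation d := (@cube_dist R).
Hypotheses (Pc : P `<=` cube) (clP : cube_closed P).
Context (m : nat) (ka : {ptws nat -> R} -> 'rV[R]_m) (L : R).
Hypothesis lip : forall x z l, P x -> P z -> `|ka x 0 l - ka z 0 l| <= L * d x z.

Lemma lip_near x z l g : P x -> P z -> 0 < g -> d x z < g / (`|L| + 1) ->
  `|ka x 0 l - ka z 0 l| <= g.
Proof.
move=> Px Pz g0; rewrite ltr_pdivlMr ?ltr_wpDl // => dg.
apply: (le_trans (lip l Px Pz)); have := cube_dist_ge0 (Pc Px) (Pc Pz).
by have := ler_norm L; move: (d x z) `|L| dg => D L0; nra.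
Qed.

Lemma separation_gap (eta : R) :
  (forall x z, P x -> P z -> eta <= d x z -> ka x <> ka z) ->
  exists2 g, 0 < g & forall x z, P x -> P z -> eta <= d x z ->
    exists l, g <= `|ka x 0 l - ka z 0 l|.
Proof.
move=> sep.
pose Good g x := forall z, P z -> eta <= d x z -> exists l, g <= `|ka x 0 l - ka z 0 l|.
have [|x Px|g g0 hg] := @cube_uniform R P Good Pc clP.
- move=> g g' x gg' h z Pz /(h z Pz)[l gl]; exists l; exact: le_trans gg' gl.
(* Compactness is used in each variable in turn instead of on the product; the inner gap also holds
   for all [x1] near [x]. *)
- pose Good2 g z := forall x1, P x1 -> d x1 x < g -> eta <= d x1 z ->
    exists l, g <= `|ka x1 0 l - ka z 0 l|.
  have [|z Pz|g g0 hg] := @cube_uniform R P Good2 Pc clP.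
  + move=> g g' z gg' h x1 Px1 dx1 /(h x1 Px1 (lt_le_trans dx1 gg'))[l gl].
    exists l; exact: le_trans gg' gl.
  + have [far|close] := leP eta (d x z); last first.
      exists ((eta - d x z) / 2); first by rewrite divr_gt0 // subr_gt0.
      move=> z1 Pz1 dz1 x1 Px1 dx1 far.
      have := cube_distD (Pc Px1) (Pc Px) (Pc Pz1).
      have := cube_distD (Pc Px) (Pc Pz) (Pc Pz1).
      rewrite (cube_distC z z1) => t1 t2.
      by exfalso; lra.
    have [l kl] : exists l, ka x 0 l != ka z 0 l.
      apply: contrapT => no; apply: (sep x z Px Pz far); apply/rowP => l.
      by apply/eqP/negPn/negP => h; apply: no; exists l.
    (* Each of the two points may change its value by [g], and [g] remains. *)
    pose g := `|ka x 0 l - ka z 0 l| / 3.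
    have g0 : 0 < g by rewrite divr_gt0 // normr_gt0 subr_eq0.
    exists (Num.min g (g / (`|L| + 1))).
      by rewrite lt_min g0 divr_gt0 // ltr_wpDl.
    move=> z1 Pz1; rewrite lt_min => /andP[_ dz1] x1 Px1.
    rewrite lt_min => /andP[_ dx1] _; exists l; rewrite ge_min; apply/orP; left.
    have := lip_near l Px1 Px g0 dx1; have := lip_near l Pz1 Pz g0 dz1.
    have : 3 * g = `|ka x 0 l - ka z 0 l| by rewrite /g; field.
    have := ler_normD (ka x 0 l - ka x1 0 l) (ka x1 0 l - ka z 0 l).
    have := ler_normD (ka x1 0 l - ka z1 0 l) (ka z1 0 l - ka z 0 l).
    rewrite !subrKA (distrC (ka x 0 l) (ka x1 0 l)).
    lra.
  + exists g => // x1 Px1 dx1 z Pz; exact: hg.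
- by exists g => // x z Px; apply: hg.
Qed.

Lemma rational_gap n s (Q : 'I_s -> R) :
  (forall x, P x -> (#|[pred l | [exists i : 'I_s, ka x 0%R l == Q i]]| <= n)%N) ->
  exists2 g, 0 < g & forall x, P x ->
    (#|[pred l | [exists i : 'I_s, (`|ka x 0 l - Q i| <= g)%R]]| <= n)%N.
Proof.
move=> rat.
apply: (@cube_uniform R P (fun g x =>
  (#|[pred l | [exists i : 'I_s, (`|ka x 0 l - Q i| <= g)%R]]| <= n)%N)) => //.
- move=> g g' x gg'; apply: leq_trans; apply: subset_leq_card.
  apply/fintype.subsetP => l /existsP[i h]; apply/existsP; exists i.
  exact: le_trans h gg'.
- move=> x Px.
  (* [g] is below all nonzero distances at [x], so a coordinate within [g / 3] of [Q i] at a nearby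
     point equals [Q i] at [x]. *)
  have [g g0 hg] := finite_pos_bound (fun li : 'I_m * 'I_s => `|ka x 0 li.1 - Q li.2|).
  have g3 : 0 < g / 3 by rewrite divr_gt0.
  exists (Num.min (g / 3) (g / 3 / (`|L| + 1))).
    by rewrite lt_min g3 divr_gt0 // ltr_wpDl.
  move=> z Pz; rewrite lt_min => /andP[_ dz].
  apply: leq_trans (rat x Px); apply: subset_leq_card.
  apply/fintype.subsetP => l /existsP[i]; rewrite le_min => /andP[h _]; apply/existsP; exists i.
  rewrite -subr_eq0 -normr_le0 leNgt; apply/negP => /(hg (l, i)) /= hg1.
  have := lip_near l Pz Px g3 dz.
  have := ler_normD (ka x 0 l - ka z 0 l) (ka z 0 l - Q i).
  rewrite subrKA (distrC (ka x 0 l) (ka z 0 l)); lra.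
Qed.

End Gaps.

(* Keeps [lra] from unfolding these constants when it compares atoms. *)
#[local] Opaque tab_N tab_e tab_t tab_size tab_pt tab_val cube_dist.

Section ExtendTables.
Context {R : realType} (P : set {ptws nat -> R}) (c r : nat -> nat) (n : nat).
Hypothesis PE : P = @hilbert_cube R `\`
  \bigcup_k [set x | cube_dist x (cube_dense (c k)) < ratr (rat_of_code (r k))].
Hypothesis dimP : covering_dim_lt P n.+1.

Local Notation half n := (2^-1 ^+ n : R).
Local Notation cube := (@hilbert_cube R).
Local Notation d := (@cube_dist R).
Local Notation pt w j := (@cube_dense R (tab_pt w j)).
Local Notation tol w := ((tab_e w).+1%:R^-1 : R).
Local Notation m := (2 * n + 1)%N.
Local Notation co w j l := (@tab_coord R w j l).

Lemma exists_valid_table : exists w, tab_valid c r m w.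
Proof.
have [|w [_ _ cov tame _]] := @build_table R P c r PE m (fun _ _ => 0) 0 0 0.
  by move=> x z l *; rewrite subrr normr0 mul0r.
by exists w; apply/andP.
Qed.

Lemma tab_coherentP u w i j : tab_coherent m u w -> (i < tab_size u)%N ->
  (j < tab_size w)%N -> d (pt u i) (pt w j) < half (tab_N u) + half (tab_N w) ->
  forall l, (l < m)%N -> `|co u i l - co w j l| <= tol u - tol w.
Proof.
move=> /all_iotaP coh ilt jlt dij.
have /all_iotaP/(_ j jlt)/implyP h := coh i ilt.
have {h} : vec_close m (tab_val u i) (tab_val w j) (tab_tol u - tab_tol w).
  apply: h; rewrite -(ltr_rat R) -cube_dist_dense rmorphD /= !ratr_half.
  exact: dij.
by rewrite (vec_closeP (R := R)) rmorphB /= !ratr_tol.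
Qed.

Lemma tab_tameP u i j : tab_tame m u -> (i < tab_size u)%N ->
  (j < tab_size u)%N -> d (pt u i) (pt u j) < half (tab_N u) + half (tab_N u) ->
  forall l, (l < m)%N -> `|co u i l - co u j l| <= tol u / 4.
Proof.
move=> /all_iotaP tame ilt jlt dij l lm.
have /all_iotaP/(_ j jlt)/implyP h := tame i ilt.
have {h} : vec_close m (tab_val u i) (tab_val u j) (tab_tol u * 2^-1 ^+ 2).
  apply: h; rewrite -(ltr_rat R) -cube_dist_dense rmorphD /= !ratr_half.
  exact: dij.
rewrite (vec_closeP (R := R)) rmorphM /= ratr_tol ratr_half => /(_ l lm).
by rewrite (_ : half 2 = 4^-1) // expr2; field.
Qed.

(** The search terminates: the piecewise constant map of [u] is approximated by a generic map, which
    is sampled again. That map stays within [tol u / 2] of the old values, one quarter from tameness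
    and one from the perturbation. *)
Lemma tab_extend s u : tab_valid c r m u -> exists w, tab_step c r m n s u w.
Proof.
move=> /andP[covu tameu].
have Pc := Pi01_sub PE; have clP := Pi01_closed PE.
have ex x : exists i, P x -> (i < tab_size u)%N /\ d x (pt u i) < half (tab_N u).+1.
  have [Px|] := pselect (P x); last by exists 0%N.
  by have [i ilt di] := tab_coversP PE covu Px; exists i.
have {ex}[ix hix] := choice ex.
pose ta x : 'rV[R]_m := \row_l co u (ix x) l.
pose Q (i : 'I_s.+1) : R := ratr (rat_of_code i).
have tolu := tol_gt0 (R := R) u.
have [ka [L [lip app sep rat]]] := @separating_map R P n s.+1 ta Q
  (half (tab_N u + s + 3)) (tol u / 4) Pc clP dimP (half_gt0 _)
  ltac:(by rewrite divr_gt0).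
have [g1 g10 gap1] := separation_gap Pc clP lip sep.
have [g2 g20 gap2] := rational_gap Pc clP lip rat.
(* [g1 / 5] leaves [4 tol w] after two errors of [tol w / 12]; [g2 / 2] covers [tol w + tol w / 12];
   [tol u / 4] serves coherence and [half s] smallness. *)
pose D := Num.min (Num.min (g1 / 5) (g2 / 2)) (Num.min (tol u / 4) (half s)).
have D0 : 0 < D by rewrite !lt_min !divr_gt0 // half_gt0.
have [e he] := exists_nat_gt D^-1.
have eD : e.+1%:R^-1 <= D.
  rewrite -[D]invrK lef_pV2 ?posrE ?invr_gt0 ?ltr0n //.
  by apply: le_trans (ltW he) _; rewrite ler_nat.
move: eD; rewrite !le_min => /andP[/andP[eg1 eg2] /andP[eu es]].
pose kn x l := oapp (fun i : 'I_m => ka x 0 i) 0 (insub l).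
have knE x l (lm : (l < m)%N) : kn x l = ka x 0 (Ordinal lm) by rewrite /kn insubT.
have [|w [we wN covw tamew wP]] := @build_table R P c r PE m kn L e (tab_N u + s + 3).
  by move=> x z l lm Px Pz; rewrite !knE; apply: lip.
have radw : half (tab_N w) <= half (tab_N u + s + 3) by exact: half_le.
have radu : half (tab_N u + s + 3) <= half (tab_N u).+3.
  by apply: half_le; rewrite -addn3 leq_add2r leq_addr.
have rads : half (tab_N u + s + 3) <= half s.+3.
  by apply: half_le; rewrite -addn3 leq_add2r leq_addl.
have hu : half (tab_N u) = 8 * half (tab_N u).+3 by rewrite !exprS; field.
have hu1 : half (tab_N u).+1 = 4 * half (tab_N u).+3 by rewrite !exprS; field.
have hs : half s = 8 * half s.+3 by rewrite !exprS; field.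
(* With [h = half (tab_N u).+3], the centre chosen for [z] is less than 4h + h + 8h + 2h = 15h from
   centre [i], below the sum 16h of the radii, so tameness applies. *)
have app_u x i l (lm : (l < m)%N) : P x -> (i < tab_size u)%N ->
    d x (pt u i) < half (tab_N u) + half (tab_N w) + half (tab_N w) ->
    `|co u i l - ka x 0 (Ordinal lm)| <= tol u / 4 + tol u / 4.
  move=> Px ilt dxi; rewrite distrC.
  have -> : co u i l = (\row_(k < m) co u i k) 0 (Ordinal lm) by rewrite mxE.
  apply: (app x) => // z k Pz dxz.
  rewrite !mxE; have [zlt dz] := hix z Pz.
  apply: tab_tameP => //.
  have := cube_distD (cube_dense_cube (tab_pt u (ix z))) (Pc z Pz)
    (cube_dense_cube (R := R) (tab_pt u i)).
  have := cube_distD (Pc z Pz) (Pc x Px) (cube_dense_cube (R := R) (tab_pt u i)).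
  rewrite (cube_distC _ z) (cube_distC z x).
  move: (half_gt0 (R := R) (tab_N u).+3) radw radu dxi dxz dz; rewrite hu1 hu.
  move: (half (tab_N u).+3) (half (tab_N w)) (half _) (d x z) (d z _) (d z _) (d x _) (d _ _).
  by clear; intros; lra.
have near_u i j x : (i < tab_size u)%N -> P x -> d x (pt w j) < half (tab_N w) ->
    d (pt u i) (pt w j) < half (tab_N u) + half (tab_N w) ->
    d x (pt u i) < half (tab_N u) + half (tab_N w) + half (tab_N w).
  move=> ilt Px dxj dij.
  have := cube_distD (Pc x Px) (cube_dense_cube (tab_pt w j)) (cube_dense_cube (tab_pt u i)).
  rewrite (cube_distC (pt w j) (pt u i)); move: dxj dij.
  move: (d x _) (d _ _) (d x _) (half _) (half _); clear; intros; lra.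
have ew : tol w = e.+1%:R^-1 by rewrite we.
have tolw := tol_gt0 (R := R) w.
exists w; rewrite /tab_step /tab_valid covw tamew /=; apply/and4P; split.
- apply/all_iotaP => i ilt; apply/all_iotaP => j jlt; apply/implyP.
  rewrite -(ltr_rat R) -cube_dist_dense rmorphD /= !ratr_half => dij.
  rewrite (vec_closeP (R := R)) rmorphB /= !ratr_tol => l lm.
  have [x Px [dxj vx]] := wP j jlt.
  have := app_u x i l lm Px ilt (near_u i j x ilt Px dxj dij).
  have := vx l lm; rewrite knE distrC -ew in eu *.
  have := ler_normD (co u i l - ka x 0 (Ordinal lm)) (ka x 0 (Ordinal lm) - co w j l).
  rewrite subrKA; move: (tol u) (tol w) eu tolw `|_| `|_| `|_|.
  by clear; intros; lra.
- apply/all_iotaP => i ilt; apply/all_iotaP => j jlt; apply/implyP.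
  rewrite -(ler_rat R) -cube_dist_dense ratr_half => far.
  have [x Px [dxi vx]] := wP i ilt; have [z Pz [dzj vz]] := wP j jlt.
  have farxz : half (tab_N u + s + 3) <= d x z.
    have := cube_distD (cube_dense_cube (tab_pt w i)) (Pc x Px)
      (cube_dense_cube (R := R) (tab_pt w j)).
    have := cube_distD (Pc x Px) (Pc z Pz) (cube_dense_cube (R := R) (tab_pt w j)).
    rewrite (cube_distC _ x); move: far dxi dzj radw rads (half_gt0 (R := R) s.+3).
    rewrite hs; move: (half s.+3) (half (tab_N w)) (half _) (d x z) (d z _) (d x _) (d x _) (d _ _).
    by clear; intros; lra.
  have [l gl] := gap1 x z Px Pz farxz; apply/has_iotaP; exists (val l); first exact: ltn_ord.
  rewrite /= -(ler_rat R) ratr_norm rmorphB rmorphM /= ratr_tol ratr_nat.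
  rewrite -!/(tab_coord _ _ _).
  have := vx l (ltn_ord l); have := vz l (ltn_ord l).
  have lE : Ordinal (ltn_ord l) = l by exact: val_inj.
  rewrite !knE lE.
  have := ler_normD (ka x 0 l - co w i l) (co w i l - ka z 0 l).
  have := ler_normD (co w i l - co w j l) (co w j l - ka z 0 l).
  rewrite !subrKA (distrC (ka x 0 l) (co w i l)).
  move: gl eg1; rewrite -ew; move: (tol w) tolw `|_| `|_| `|_| `|_| `|_|.
  by clear; intros; lra.
- apply/all_iotaP => j jlt; have [x Px [dxj vx]] := wP j jlt.
  rewrite count_iota_card; apply: leq_trans (gap2 x Px); apply: subset_leq_card.
  apply/fintype.subsetP => l /has_iotaP[i ilt h]; apply/existsP; exists (Ordinal ilt).
  move: h; rewrite /= -(ler_rat R) ratr_norm rmorphB /= ratr_tol -/(tab_coord _ _ _) => h.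
  have := vx l (ltn_ord l); rewrite knE (_ : Ordinal (ltn_ord l) = l); last exact/val_inj.
  have := ler_normD (ka x 0 l - co w j l) (co w j l - Q (Ordinal ilt)).
  rewrite subrKA (distrC (ka x 0 l) (co w j l)); move: h eg2; rewrite /Q /= -ew.
  move: (tol w) tolw `|_| `|_| `|_|; clear; intros; lra.
- rewrite /tab_small -(ler_rat R) ratr_tol ratr_half ew es andbT.
  by apply: leq_trans wN; rewrite addnAC leq_addl.
Qed.

End ExtendTables.

(** * The limit map *)

Section MaxNorm.
Context {R : realType} (k : nat).
Implicit Types x y : 'rV[R]_k.

Lemma rvec_dist_le x y e : 0 <= e -> (forall l, `|x 0 l - y 0 l| <= e) ->
  rvec_dist x y <= e.
Proof.
move=> e0 h; rewrite /rvec_dist /Num.norm /=.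
have [->//|/mx_norm_neq0[[i l] ->]] := eqVneq (mx_norm (x - y)) 0.
by rewrite /= (ord1 i) !mxE.
Qed.

Lemma rvec_coord_dist x y l : `|x 0 l - y 0 l| <= rvec_dist x y.
Proof.
rewrite /rvec_dist /Num.norm /= mx_normrE.
have := le_bigmax 0 (fun ij : 'I_1 * 'I_k => `|(x - y) ij.1 ij.2|) (0, l).
by rewrite /= !mxE.
Qed.

Lemma rvec_distD y x z : rvec_dist x z <= rvec_dist x y + rvec_dist y z.
Proof. by rewrite /rvec_dist -{1}(subrKA y); apply: ler_normD. Qed.
End MaxNorm.

Section CauchyNames.
Context {R : realType} (X : Type) (d : X -> X -> R) (a : nat -> X).
Local Notation half n := (2^-1 ^+ n : R).

Lemma cauchy_name_dist p x n : (forall y z, d (a y) x <= d (a y) (a z) + d (a z) x) ->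
  cauchy_name d a p x -> d (a (p n)) x <= half n.
Proof.
move=> tri [cauchy lim]; apply: ler_add_half => k.
have [N _ hN] := (cvgrPdist_lt _ _).1 lim (half k) (half_gt0 k).
have := hN (maxn n N) (leq_maxr n N); rewrite sub0r normrN => h.
have := cauchy n (maxn n N) (leq_maxl n N).
have := tri (p n) (p (maxn n N)); have := ler_norm (d (a (p (maxn n N))) x).
lra.
Qed.

Lemma cauchy_nameI p x : (forall n, 0 <= d (a (p n)) x) ->
  (forall n, d (a (p n)) (a (p n)) <= 0) ->
  (forall n m, (n < m)%N -> d (a (p n)) (a (p m)) < half n) ->
  (forall n, d (a (p n)) x <= half n) -> cauchy_name d a p x.
Proof.
move=> d0 dxx dlt dle; split=> [n m|].
  rewrite leq_eqVlt => /orP[/eqP <-|/dlt //].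
  exact: le_lt_trans (dxx n) (half_gt0 n).
apply/cvgrPdist_lt => e /exists_half_lt[N hN]; exists N => // n /= Nn.
rewrite sub0r normrN ger0_norm //; apply: le_lt_trans (dle n) _.
by apply: le_lt_trans hN; apply: half_le.
Qed.
End CauchyNames.

Lemma exists_least (C : nat -> bool) : (exists w, C w) ->
  exists w, C w /\ forall v, (v < w)%N -> ~~ C v.
Proof.
move=> ex; case: (ex_minnP ex) => w Cw wmin; exists w; split=> // v vw.
by apply/negP => /wmin; rewrite leqNgt vw.
Qed.

Section LimitMap.
Context {R : realType} (P : set {ptws nat -> R}) (c r : nat -> nat) (n : nat).
Hypothesis PE : P = @hilbert_cube R `\`
  \bigcup_k [set x | cube_dist x (cube_dense (c k)) < ratr (rat_of_code (r k))].

Local Notation half n := (2^-1 ^+ n : R).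
Local Notation cube := (@hilbert_cube R).
Local Notation d := (@cube_dist R).
Local Notation pt w j := (@cube_dense R (tab_pt w j)).
Local Notation tol w := ((tab_e w).+1%:R^-1 : R).
Local Notation m := (2 * n + 1)%N.
Local Notation co w j l := (@tab_coord R w j l).

Context (W : nat -> nat).
Hypothesis W0 : tab_valid c r m (W 0).
Hypothesis WS : forall s, tab_step c r m n s (W s) (W s.+1).

Definition tab_near s x j :=
  (j < tab_size (W s))%N /\ d x (pt (W s) j) < half (tab_N (W s)).

Let Pc : P `<=` cube := Pi01_sub PE.

Lemma W_covers s : tab_covers c r (W s).
Proof. by case: s => [|s]; [case/andP: W0|case/andP: (WS s) => /andP[]]. Qed.

Lemma exists_half_near s x : exists j, P x -> (j < tab_size (W s))%N /\
  d x (pt (W s) j) < half (tab_N (W s)).+1.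
Proof.
have [Px|] := pselect (P x); last by exists 0%N.
by have [j jlt dj] := tab_coversP PE (W_covers s) Px; exists j.
Qed.

Lemma W_small s : half (tab_N (W s.+1)) <= half s /\ tol (W s.+1) <= half s.
Proof.
have /and5P[_ _ _ _ /andP[h1 h2]] := WS s; split; first exact: half_le.
by move: h2; rewrite -(ler_rat R) ratr_tol ratr_half.
Qed.

Lemma half_double k : half k.+1 < half k.
Proof. by have := halfS (R := R) k; have := half_gt0 (R := R) k.+1; lra. Qed.

Lemma near_step s x i j : P x -> tab_near s x i -> tab_near s.+1 x j ->
  forall l, (l < m)%N -> `|co (W s) i l - co (W s.+1) j l| <= tol (W s) - tol (W s.+1).
Proof.
move=> Px [ilt di] [jlt dj]; have /and5P[_ coh _ _ _] := WS s.
apply: (tab_coherentP coh) => //; rewrite cube_distC in di.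
apply: le_lt_trans (ltrD di dj).
exact: cube_distD (cube_dense_cube _) (Pc Px) (cube_dense_cube _).
Qed.

Lemma near_nested s k x i j : P x -> tab_near s x i -> tab_near (s + k.+1) x j ->
  forall l, (l < m)%N ->
  `|co (W s) i l - co (W (s + k.+1)) j l| <= tol (W s) - tol (W (s + k.+1)).
Proof.
move=> Px ni; elim: k j => [|k IH] j.
  by rewrite addn1; apply: near_step.
rewrite addnS => nj l lm; have [i' hi'] := exists_half_near (s + k.+1) x.
have ni' : tab_near (s + k.+1) x i'.
  by have [i'lt di'] := hi' Px; split=> //; apply: lt_trans di' (half_double _).
have := IH i' ni' l lm; have := near_step Px ni' nj lm.
have := ler_normD (co (W s) i l - co (W (s + k.+1)) i' l)
  (co (W (s + k.+1)) i' l - co (W (s + k.+1).+1) j l).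
rewrite subrKA; move: (`|_|) (`|_|) (`|_|) (tol _) (tol _) (tol _).
by intros; lra.
Qed.

Lemma limit_map : exists f : {ptws nat -> R} -> 'rV[R]_m,
  forall x s j, P x -> tab_near s x j ->
  forall l : 'I_m, `|co (W s) j l - f x 0 l| <= tol (W s).
Proof.
have ex x : exists y : 'rV[R]_m, P x -> forall s j, tab_near s x j ->
    forall l : 'I_m, `|co (W s) j l - y 0 l| <= tol (W s).
  have [Px|] := pselect (P x); last by exists 0.
  have [J hJ] := choice (fun s => exists_half_near s x).
  have nJ s : tab_near s x (J s).
    by have [Jlt dJ] := hJ s Px; split=> //; apply: lt_trans dJ (half_double _).
  (* The limit is the supremum of the lower ends of nested intervals; every upper end, for any near
     entry, bounds it. *)
  pose S (l : 'I_m) := [set co (W s) (J s) l - tol (W s) | s in [set: nat]].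
  have ub s j l : tab_near s x j -> ubound (S l) (co (W s) j l + tol (W s)).
    move=> nj _ [s' _ <-]; pose T := (maxn s s').+1.
    have [k Tk] : exists k, T = (s + k.+1)%N.
      by exists (maxn s s' - s)%N; rewrite addnS subnKC ?leq_maxl.
    have [k' Tk'] : exists k, T = (s' + k.+1)%N.
      by exists (maxn s s' - s')%N; rewrite addnS subnKC ?leq_maxr.
    have nT := nJ T; have nT' := nT; rewrite {1}Tk in nT; rewrite {1}Tk' in nT'.
    have := near_nested Px nj nT (ltn_ord l); rewrite -Tk.
    have := near_nested Px (nJ s') nT' (ltn_ord l); rewrite -Tk'.
    have := tol_gt0 (R := R) (W T); rewrite !ler_norml.
    move: (co _ _ _) (co _ _ _) (co _ _ _) (tol _) (tol _) (tol _); intros; lra.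
  exists (\row_l sup (S l)) => _ s j nj l; rewrite mxE.
  have S0 : S l !=set0 by exists (co (W 0) (J 0%N) l - tol (W 0)); exists 0%N.
  have h1 : sup (S l) <= co (W s) j l + tol (W s) by apply: sup_le_ub => //; apply: ub.
  (* The entry [j] need not be the chosen [J s], so the lower estimate comes from the next stage,
     which is coherent with every near entry. *)
  have h2 : co (W s.+1) (J s.+1) l - tol (W s.+1) <= sup (S l).
    apply: sup_upper_bound; last by exists s.+1.
    by split=> //; exists (co (W 0) (J 0%N) l + tol (W 0)); apply: ub.
  have := near_step Px nj (nJ s.+1) (ltn_ord l).
  rewrite ler_norml ler_norml; move: h1 h2.
  move: (co _ _ _) (co _ _ _) (tol _) (tol _) (sup _); intros; lra.
by have [f hf] := choice ex; exists f => x s j Px; apply: hf.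
Qed.

(** * Injectivity, values and computability of the limit map *)

Section WithMap.
Context (f : {ptws nat -> R} -> 'rV[R]_m).
Hypothesis fP : forall x s j, P x -> tab_near s x j ->
  forall l : 'I_m, `|co (W s) j l - f x 0 l| <= tol (W s).

Lemma exists_near s x : P x -> exists j, tab_near s x j.
Proof.
move=> Px; have [j /(_ Px)[jlt dj]] := exists_half_near s x; exists j; split=> //.
exact: lt_trans dj (half_double _).
Qed.

(** The entries [j] and [i] have values less than [4 tol] apart, so separation forces their points
    within [half s]. This serves both injectivity and the inverse. *)
Lemma value_determines_point x s i j : P x -> tab_near s.+1 x i ->
  (j < tab_size (W s.+1))%N ->
  (forall l : 'I_m, `|co (W s.+1) j l - f x 0 l| < 3 * tol (W s.+1)) ->
  d (pt (W s.+1) j) x < half s + half s.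
Proof.
move=> Px ni jlt hj; have [ilt di] := ni.
have close : d (pt (W s.+1) j) (pt (W s.+1) i) < half s.
  have /and5P[_ _ sep _ _] := WS s.
  move: sep => /all_iotaP/(_ j jlt)/all_iotaP/(_ i ilt)/implyP sep.
  rewrite ltNge; apply/negP; rewrite cube_dist_dense -ratr_half ler_rat.
  move=> /sep/has_iotaP[l lm].
  rewrite -(ler_rat R) ratr_norm rmorphB rmorphM /= ratr_tol ratr_nat.
  rewrite -!/(tab_coord _ _ _).
  have /= := fP Px ni (Ordinal lm); have /= := hj (Ordinal lm).
  have := ler_normD (co (W s.+1) j l - f x 0 (Ordinal lm))
    (f x 0 (Ordinal lm) - co (W s.+1) i l).
  rewrite subrKA (distrC (f x 0 _) (co _ _ _)).
  move: (`|_|) (`|_|) (`|_|) (tol _); intros; lra.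
rewrite cube_distC in di.
have [hN _] := W_small s; have {hN}di := lt_le_trans di hN.
apply: le_lt_trans (ltrD close di).
exact: cube_distD (cube_dense_cube _) (cube_dense_cube _) (Pc Px).
Qed.

Lemma limit_map_inj x z : P x -> P z -> f x = f z -> x = z.
Proof.
move=> Px Pz fxz; apply: cube_dist_eq0; [exact: Pc|exact: Pc|].
apply: ler_add_half => k; rewrite add0r.
have [i ni] := exists_near k.+3 Px; have [j nj] := exists_near k.+3 Pz.
have h1 : d (pt (W k.+3) j) x < half k.+2 + half k.+2.
  apply: (value_determines_point Px ni); first by case: nj.
  move=> l; rewrite fxz; apply: le_lt_trans (fP Pz nj l) _.
  by have := tol_gt0 (R := R) (W k.+3); move: (tol _) => t; lra.
have [_ h2] := nj; have [h3 _] := W_small k.+2.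
have := cube_distD (Pc Px) (cube_dense_cube (tab_pt (W k.+3) j)) (Pc Pz).
rewrite (cube_distC x (pt _ _)) (cube_distC (pt _ _) z).
have := halfS (R := R) k; have := halfS (R := R) k.+1; have := half_gt0 (R := R) k.+2.
move: h1 h2 h3; move: (d _ x) (d z _) (d x z) (half (tab_N _)); intros; lra.
Qed.

Lemma limit_map_nobeling x : P x -> nobeling n (f x).
Proof.
move=> Px; rewrite /nobeling /=.
have ex l : exists k, rational (f x ord0 l) -> f x ord0 l = ratr (rat_of_code k).
  have [[q _ qE]|no] := pselect (rational (f x ord0 l)); last by exists 0%N.
  by have [k kq] := rat_code_surj q; exists k; rewrite kq.
(* A stage at which all rational values taken by coordinates of [f x] are already on the avoided
   list. *)
have {ex}[k hk] := choice ex; pose s := (\max_(l < m) k l)%N.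
have [j nj] := exists_near s.+1 Px; have [jlt _] := nj.
have /and5P[_ _ _ avoid _] := WS s.
move: avoid => /all_iotaP/(_ j jlt); rewrite count_iota_card; apply: leq_trans.
apply: subset_leq_card; apply/fintype.subsetP => l; rewrite !inE => /asboolP rl.
apply/has_iotaP; exists (k l); first by rewrite ltnS (leq_bigmax l).
rewrite -(ler_rat R) ratr_norm rmorphB /= ratr_tol -(hk l (asboolW rl)).
exact: fP Px nj l.
Qed.

Hypothesis cW : forall E (o : E -> nat -> nat) vs N,
  cmp o vs N -> cmp o vs (fun x => W (N x)).

(** Here [a0] to [a3] stand for [half N] to [half N.+3]. *)
Lemma search_hit (u v w a0 a1 a2 a3 : R) : u <= v + w -> v <= a3 -> w < a1 ->
  0 < a3 -> a0 = a1 + a1 -> a1 = a2 + a2 -> a2 = a3 + a3 -> u < 3 * a2.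
Proof. lra. Qed.

Lemma search_near (u v w a0 a1 a2 a3 : R) : u <= v + w -> v <= a3 -> w < 3 * a2 ->
  0 < a3 -> a0 = a1 + a1 -> a1 = a2 + a2 -> a2 = a3 + a3 -> u < a0.
Proof. lra. Qed.

(** The point is read up to [half N.+3] and tested against the threshold [3 * half N.+2]. An entry
    whose half-size ball contains [x] passes, and every entry that passes has [x] in its full
    ball. *)
Lemma limit_map_computable :
  computable_on (@cube_dist R) (@cube_dense R)
    (@rvec_dist R m) (@rvec_dense R m) P f.
Proof.
pose F (p : nat -> nat) k :=
  tab_val (W k.+2) (find (fun j =>
    qdist (p (tab_N (W k.+2)).+3) (tab_pt (W k.+2) j) <
      3%:R * 2^-1 ^+ (tab_N (W k.+2)).+2) (iota 0 (tab_size (W k.+2)))).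
have [e he] : cmp (E := (nat -> nat) * nat) fst [:: snd] (fun y => F y.1 y.2).
  have cw : cmp (E := (nat -> nat) * nat) fst [:: snd] (fun y => W y.2.+2).
    by apply: cW; cmp_auto.
  have cb : cmp (E := (nat -> nat) * nat) fst [:: snd]
      (fun y => y.1 (tab_N (W y.2.+2)).+3).
    by apply: (@cmp_oracle _ fst); cmp_auto.
  rewrite /F; cmp_auto.
exists e => x p Px px; exists (F p) => [k|]; first exact: (he (p, k)).
have cx := Pc Px.
have px' k : d x (cube_dense (p k)) <= half k.
  rewrite cube_distC; apply: cauchy_name_dist px => y z.
  exact: cube_distD (cube_dense_cube y) (cube_dense_cube z) cx.
have Fnear k : exists2 j, F p k = tab_val (W k.+2) j & tab_near k.+2 x j.
  set w := W k.+2; set b := p (tab_N w).+3.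
  set q : pred nat := fun j => qdist b (tab_pt w j) < 3%:R * 2^-1 ^+ (tab_N w).+2.
  have qE j : q j = (d (cube_dense b) (pt w j) < 3 * half (tab_N w).+2).
    by rewrite /q cube_dist_dense -[in RHS]ratr_half -(ratr_nat R 3) -rmorphM ltr_rat.
  have hb := px' (tab_N w).+3; rewrite -/b in hb.
  have e1 := halfS (R := R) (tab_N w); have e2 := halfS (R := R) (tab_N w).+1.
  have e3 := halfS (R := R) (tab_N w).+2; have e0 := half_gt0 (R := R) (tab_N w).+3.
  have hq : has q (iota 0 (tab_size w)).
    have [j0 /(_ Px)[j0lt dj0]] := exists_half_near k.+2 x.
    apply/has_iotaP; exists j0 => //; rewrite qE.
    rewrite cube_distC in hb; apply: search_hit hb dj0 e0 e1 e2 e3.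
    exact: cube_distD (cube_dense_cube b) cx (cube_dense_cube _).
  exists (find q (iota 0 (tab_size w))) => //.
  have jlt : (find q (iota 0 (tab_size w)) < tab_size w)%N.
    by rewrite -[X in (_ < X)%N](size_iota 0) -has_find.
  split=> //; have := nth_find 0%N hq; rewrite nth_iota // add0n qE -/w.
  move=> dj; apply: search_near hb dj e0 e1 e2 e3.
  exact: cube_distD cx (cube_dense_cube b) (cube_dense_cube _).
have tolS k : tol (W k.+2) <= half k.+1 by have [] := W_small k.+1.
have denseE w j (l : 'I_m) : rvec_dense m (tab_val w j) 0 l = co w j l by rewrite mxE.
apply: cauchy_nameI.
- by move=> k; apply: normr_ge0.
- by move=> k; rewrite /rvec_dist subrr normr0.
- move=> k k' kk'; have [i -> ni] := Fnear k; have [j -> nj] := Fnear k'.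
  apply: le_lt_trans (half_double k); apply: rvec_dist_le => [|l].
    exact/ltW/half_gt0.
  rewrite !denseE; have E' : k'.+2 = (k.+2 + (k' - k.+1).+1)%N by lia.
  rewrite E' in nj *; apply: le_trans (near_nested Px ni nj (ltn_ord l)) _.
  apply: le_trans (tolS k); rewrite lerBlDr lerDl ltW //; exact: tol_gt0.
- move=> k; have [i -> ni] := Fnear k; apply: rvec_dist_le => [|l].
    exact/ltW/half_gt0.
  rewrite denseE; apply: le_trans (fP Px ni l) _; apply: le_trans (tolS k) _.
  exact/ltW/half_double.
Qed.

(** The value is read up to [tol / 2]. Near entries pass the test at [2 tol], and any entry that
    passes is within [3 tol] of [f x], so its point is close to [x]. *)
Lemma inverse_computable (g : 'rV[R]_m -> {ptws nat -> R}) :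
  (forall x, P x -> g (f x) = x) ->
  computable_on (@rvec_dist R m) (@rvec_dense R m)
    (@cube_dist R) (@cube_dense R) (f @` P) g.
Proof.
move=> gK.
pose F (p : nat -> nat) k :=
  tab_pt (W k.+4) (find (fun j =>
    all (fun l => `|ratseq_of_code (tab_val (W k.+4) j) l -
                    ratseq_of_code (p (tab_e (W k.+4)).+1) l| <=
        2%:R * tab_tol (W k.+4)) (iota 0 m)) (iota 0 (tab_size (W k.+4)))).
have [e he] : cmp (E := (nat -> nat) * nat) fst [:: snd] (fun y => F y.1 y.2).
  have cw : cmp (E := (nat -> nat) * nat) fst [:: snd] (fun y => W y.2.+4).
    by apply: cW; cmp_auto.
  have cb : cmp (E := (nat -> nat) * nat) fst [:: snd]
      (fun y => y.1 (tab_e (W y.2.+4)).+1).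
    by apply: (@cmp_oracle _ fst); cmp_auto.
  rewrite /F; cmp_auto.
exists e => _ p [x Px <-] px; rewrite gK //.
exists (F p) => [k|]; first exact: (he (p, k)).
have cx := Pc Px.
have px' k (l : 'I_m) : `|rvec_dense m (p k) 0 l - f x 0 l| <= half k.
  apply: le_trans (rvec_coord_dist _ _ l) _; apply: cauchy_name_dist px => y z.
  exact: rvec_distD.
have Fnear k : d (cube_dense (F p k)) x < half k.+2.
  set w := W k.+4; pose b := p (tab_e w).+1.
  pose q : pred nat := fun j => vec_close m (tab_val w j) b (2%:R * tab_tol w).
  pose co' l : R := ratr (ratseq_of_code b l).
  have qE j : q j <-> forall l, (l < m)%N -> `|co w j l - co' l| <= 2 * tol w.
    rewrite /q /vec_close all_iotaP; split=> h l lm; have := h l lm;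
    by rewrite /tab_coord /co' -rmorphB -ratr_norm -(ler_rat R) rmorphM /= ratr_tol ratr_nat.
  (* Precision index [e + 1] suffices because [2 ^ e >= e + 1]. *)
  have hb (l : 'I_m) : `|co' l - f x 0 l| <= tol w / 2.
    have := px' (tab_e w).+1 l; rewrite mxE => /le_trans; apply.
    rewrite exprSr ler_wpM2r ?invr_ge0 // exprVn lef_pV2 ?posrE ?exprn_gt0 //.
    by rewrite -natrX ler_nat ltn_expl.
  have tol0 := tol_gt0 (R := R) w.
  have [j0 nj0] := exists_near k.+4 Px.
  have hq : has q (iota 0 (tab_size w)).
    apply/has_iotaP; exists j0; first by case: nj0.
    apply/qE => l lm; have := fP Px nj0 (Ordinal lm); have /= := hb (Ordinal lm).
    rewrite -/w /=.
    have := ler_normD (co w j0 l - f x 0 (Ordinal lm)) (f x 0 (Ordinal lm) - co' l).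
    rewrite subrKA (distrC (f x 0 _) (co' l)).
    move: (`|_|) (`|_|) (`|_|) (tol w) tol0; intros; lra.
  have jlt : (find q (iota 0 (tab_size w)) < tab_size w)%N.
    by rewrite -[X in (_ < X)%N](size_iota 0) -has_find.
  rewrite (halfS k.+2); apply: (value_determines_point Px nj0 jlt) => l.
  have := nth_find 0%N hq; rewrite nth_iota // add0n => /qE/(_ l (ltn_ord l)).
  have := hb l; rewrite -/w; move: (find _ _) => j.
  have := ler_normD (co w j l - co' l) (co' l - f x 0 l).
  rewrite subrKA; move: (`|_|) (`|_|) (`|_|) (tol w) tol0; intros; lra.
apply: cauchy_nameI.
- by move=> k; apply: cube_dist_ge0 => //; apply: cube_dense_cube.
- by move=> k; rewrite cube_distxx //; apply: cube_dense_cube.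
- move=> k k' kk'.
  apply: le_lt_trans (half_double k); rewrite (halfS k.+1).
  apply: le_trans (cube_distD (cube_dense_cube _) cx (cube_dense_cube _)) _.
  rewrite (cube_distC x); apply: lerD; first exact/ltW/Fnear.
  by apply: le_trans (ltW (Fnear k')) _; apply: half_le; rewrite !ltnS ltnW.
- move=> k; apply: le_trans (ltW (Fnear k)) _; apply: half_le.
  exact: leq_trans (leqnSn _) (leqnSn _).
Qed.

End WithMap.
End LimitMap.

Theorem theorem3p7 (R : realType) (n : nat) (P : set {ptws nat -> R})
    (hP : Pi01_cube P) (hdim : covering_dim_eq P n) :
  exists (f : {ptws nat -> R} -> 'rV[R]_(2 * n + 1))
         (g : 'rV[R]_(2 * n + 1) -> {ptws nat -> R}),
    [/\ forall x, P x -> nobeling n (f x),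
        set_inj P f,
        computable_on (@cube_dist R) (@cube_dense R)
          (@rvec_dist R (2 * n + 1)) (@rvec_dense R (2 * n + 1)) P f,
        forall x, P x -> g (f x) = x &
        computable_on (@rvec_dist R (2 * n + 1)) (@rvec_dense R (2 * n + 1))
          (@cube_dist R) (@cube_dense R) (f @` P) g].
Proof.
have [c [r [cc cr PE]]] := hP; have [dimP _] := hdim.
have [u0 u0P] := exists_valid_table n PE.
(* Choosing the least extension makes the sequence the one that unbounded search produces. The
   arbitrary value at an invalid table is never reached, since extensions are valid. *)
have ex (su : nat * nat) : exists w, tab_valid c r (2 * n + 1) su.2 ->
    tab_step c r (2 * n + 1) n su.1 su.2 w /\
    forall v, (v < w)%N -> ~~ tab_step c r (2 * n + 1) n su.1 su.2 v.
  have [val|] := boolP (tab_valid c r (2 * n + 1) su.2); last by exists 0%N.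
  by have [w hw] := exists_least (tab_extend PE dimP su.1 val); exists w.
have {ex}[step stepP] := choice ex.
have [W [Wvalid WS Wmin]] : exists W : nat -> nat, [/\ forall s, tab_valid c r (2 * n + 1) (W s),
    forall s, tab_step c r (2 * n + 1) n s (W s) (W s.+1) &
    forall s w, (w < W s.+1)%N -> ~~ tab_step c r (2 * n + 1) n s (W s) w].
  pose W := fix W s := if s is t.+1 then step (t, W t) else u0.
  have Wvalid s : tab_valid c r (2 * n + 1) (W s).
    elim: s => [|s IH]; first exact: u0P.
    by have [/and5P[]] := stepP (s, W s) IH.
  by exists W; split=> // s; have [] := stepP (s, W s) (Wvalid s).
have W0 := Wvalid 0%N.
have cW := cmp_search WS Wmin (bcmp_tab_step (2 * n + 1) n cc cr).
have [f fP] := limit_map PE W0 WS.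
have fI := limit_map_inj PE W0 WS fP.
pose g y := xget (fun=> 0) [set x | P x /\ f x = y].
have gK x : P x -> g (f x) = x.
  move=> Px; rewrite /g; case: xgetP => [z _ [Pz fz]|/(_ x) []//].
  exact: fI.
exists f, g; split=> //.
- by move=> x Px; apply: (limit_map_nobeling PE W0 WS fP).
- by move=> x z /set_mem Px /set_mem Pz; apply: fI.
- exact (limit_map_computable PE W0 WS fP cW).
- exact (inverse_computable PE W0 WS fP cW gK).
Qed.
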